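(* Let $g$ be a $C^1$ function near $0$ in $\mathbb{R}$ with $g(0)=0$, $g'(0)>0$, and consider the system in $\mathbb{R}^4$ (coordinates $(x,y,\dot x,\dot y)$) \[ \ddot x=-g(x),\qquad \ddot y=-g'(x)\,y . \] Then the origin of $\mathbb{R}^4$ is a (Lyapunov) stable equilibrium of this system if and only if the origin of $\mathbb{R}^2$ is a locally isochronous center for $\ddot x=-g(x)$; in this case all orbits of the system with $(x,\dot x)$ near $(0,0)$ are periodic and have the same period. If the equilibrium is unstable, then there is a sequence of initial data converging to the origin whose corresponding solutions are unbounded, and the instability is weak, i.e. there are no asymptotic motions to the equilibrium: no solution (other than the equilibrium itself) tends to the origin as $t\to-\infty$.
   Context: Let $V(x)=\int_0^x g(s)\,ds$. The origin of $\mathbb{R}^2$ is a locally isochronous center for $\ddot x=-g(x)$ if there is an open interval $J\ni0$ such that $V$ is strictly increasing on $J\cap(0,\infty)$, strictly decreasing on $J\cap(-\infty,0)$, for each $x\in J$ there is a unique $h(x)\in J$ with $V(h(x))=V(x)$ and $\operatorname{sgn}h(x)=-\operatorname{sgn}x$, and all orbits of $\ddot x=-g(x)$ in the $(x,\dot x)$-plane meeting $J\times\{0\}$ (which are periodic orbits enclosing the origin) have the same period. *)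

(* Defs.v *)
From Stdlib Require Import Reals.
From Coquelicot Require Import Coquelicot.
Open Scope R_scope.

Definition norm4 (a b c d : R) : R := sqrt (a ^ 2 + b ^ 2 + c ^ 2 + d ^ 2).

Definition sgn (s : R) : R :=
  if Rlt_dec 0 s then 1 else if Rlt_dec s 0 then -1 else 0.

(* (x,y,u,v) is a solution on the set of times I of the first-order system
     x' = u, u' = -g(x), y' = v, v' = -g'(x) y
   (with dg = g'), the system being defined for -r < x < r,
   where g is C^1. *)
Definition sys_sol (g dg : R -> R) (r : R) (I : R -> Prop)
  (x y u v : R -> R) : Prop :=
  forall t, I t ->
    (-r < x t < r) /\
    is_derive x t (u t) /\ is_derive u t (- g (x t)) /\
    is_derive y t (v t) /\ is_derive v t (- dg (x t) * y t).

Definition sys_init (x y u v : R -> R) (x0 y0 u0 v0 : R) : Prop :=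
  x 0 = x0 /\ y 0 = y0 /\ u 0 = u0 /\ v 0 = v0.

Definition lyap_stable (g dg : R -> R) (r : R) : Prop :=
  forall eps, 0 < eps -> exists delta, 0 < delta /\
    forall x0 y0 u0 v0, norm4 x0 y0 u0 v0 < delta ->
      (exists a, a < 0 /\ exists x y u v,
          sys_sol g dg r (fun t => a < t) x y u v /\
          sys_init x y u v x0 y0 u0 v0) /\
      (forall a b x y u v, a < 0 < b ->
          sys_sol g dg r (fun t => a < t < b) x y u v ->
          sys_init x y u v x0 y0 u0 v0 ->
          forall t, 0 <= t < b -> norm4 (x t) (y t) (u t) (v t) < eps).

Definition sol2 (g : R -> R) (r : R) (I : R -> Prop) (x u : R -> R) : Prop :=
  forall t, I t -> (-r < x t < r) /\
    is_derive x t (u t) /\ is_derive u t (- g (x t)).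

Definition min_period2 (x u : R -> R) (T : R) : Prop :=
  0 < T /\ (forall t, x (t + T) = x t /\ u (t + T) = u t) /\
  (forall s, 0 < s < T -> ~ (x s = x 0 /\ u s = u 0)).

Definition V (g : R -> R) (s : R) : R := RInt g 0 s.

(* The origin of R^2 is a locally isochronous center for x'' = -g(x):
   there is an open interval J = (a,b) containing 0 (inside the domain
   (-r,r) of g) with V strictly increasing on J /\ (0,oo), strictly
   decreasing on J /\ (-oo,0), the "involution" h well defined, and all
   orbits through J x {0} (other than the equilibrium) periodic with one
   common (minimal) period. *)
Definition loc_iso_center (g : R -> R) (r : R) : Prop :=
  exists a b, a < 0 < b /\ -r <= a /\ b <= r /\
    (forall s1 s2, 0 < s1 -> s1 < s2 -> s2 < b -> V g s1 < V g s2) /\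
    (forall s1 s2, a < s1 -> s1 < s2 -> s2 < 0 -> V g s2 < V g s1) /\
    (forall s, a < s < b ->
        exists! z, (a < z < b) /\ V g z = V g s /\ sgn z = - sgn s) /\
    (exists T, 0 < T /\
       forall s, a < s < b -> s <> 0 ->
         (exists x u, sol2 g r (fun _ => True) x u /\ x 0 = s /\ u 0 = 0) /\
         (forall x u, sol2 g r (fun _ => True) x u -> x 0 = s -> u 0 = 0 ->
             min_period2 x u T)).

Definition all_periodic_same_period (g dg : R -> R) (r : R) : Prop :=
  exists T, 0 < T /\ exists rho, 0 < rho /\
    forall x0 y0 u0 v0, sqrt (x0 ^ 2 + u0 ^ 2) < rho ->
      (exists x y u v, sys_sol g dg r (fun _ => True) x y u v /\
                       sys_init x y u v x0 y0 u0 v0) /\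
      (forall x y u v, sys_sol g dg r (fun _ => True) x y u v ->
         sys_init x y u v x0 y0 u0 v0 ->
         (forall t, x (t + T) = x t /\ y (t + T) = y t /\
                    u (t + T) = u t /\ v (t + T) = v t) /\
         (~ (x0 = 0 /\ y0 = 0 /\ u0 = 0 /\ v0 = 0) ->
            forall s, 0 < s < T ->
              ~ (x s = x0 /\ y s = y0 /\ u s = u0 /\ v s = v0))).

Definition unbounded_near_origin (g dg : R -> R) (r : R) : Prop :=
  exists X Y U W : nat -> R,
    is_lim_seq (fun n => norm4 (X n) (Y n) (U n) (W n)) 0 /\
    forall n,
      (exists a, a < 0 /\ exists x y u v,
          sys_sol g dg r (fun t => a < t) x y u v /\
          sys_init x y u v (X n) (Y n) (U n) (W n)) /\
      (forall a x y u v, a < 0 ->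
          sys_sol g dg r (fun t => a < t) x y u v ->
          sys_init x y u v (X n) (Y n) (U n) (W n) ->
          ~ (exists M, forall t, 0 <= t -> norm4 (x t) (y t) (u t) (v t) <= M)).

Definition no_asymptotic_motions (g dg : R -> R) (r : R) : Prop :=
  forall T x y u v,
    sys_sol g dg r (fun t => t < T) x y u v ->
    is_lim (fun t => norm4 (x t) (y t) (u t) (v t)) m_infty 0 ->
    forall t, t < T -> x t = 0 /\ y t = 0 /\ u t = 0 /\ v t = 0.

(* Main.v *)
Require Import Defs.
From Stdlib Require Import Reals Lra Lia Psatz Ranalysis5 ClassicalEpsilon.
From Coquelicot Require Import Coquelicot.
Open Scope R_scope.

(** Let [x] be the orbit of [x'' = - g x] starting at rest at [A > 0], let [t1 A] be the first
    time it comes to rest again, so that its period is [2 * t1 A], and let [y] be the solution of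
    [y'' = - g'(x) y] starting at [(1, 0)].  Differentiating the flow in [A] shows that
    [t1' A = 0] as soon as [y' (t1 A) = 0].  If that happens for all small [A], the period is
    constant.  Otherwise, by the symmetries of the orbit, [y] gains a nonzero multiple of [x'] over
    each period, so it is unbounded, and scaling the initial data of [y] gives unbounded solutions
    arbitrarily close to the origin.  Conversely, if the period is constant, the time-[T] map of
    the planar flow is the identity near the origin, hence so is its derivative; all solutions of
    the system are then [T]-periodic, and Gronwall's inequality on one period gives stability.
    Conservation of energy excludes asymptotic motions. *)

(** The system conserves [u * v + g x * y], but this form is indefinite, so stability cannot be read
    off from it and has to come from periodicity. The force is only [C ^ 1] and only local. It is
    traded for a globally Lipschitz one, whose flow exists for all times, and an energy barrier
    keeps small orbits where the two agree. No second derivative is available for a Taylor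
    remainder; uniform continuity of the first derivative replaces it. Formally, differentiating
    [U A (t1 A) = 0] in [A] gives [v (t1 A) - G (X A (t1 A)) * t1' A = 0], and the force at a
    turning point is not zero. Since [t1'] is wanted only where it vanishes, the case distinction is
    made on [v (t1 A)] itself: [t1] is never differentiated at other amplitudes, and no implicit
    function theorem enters. Solutions with [x] at rest are harmonic in [y]. Their minimal period
    must equal that of the planar orbits, which takes a separate identity for the frequency
    [sqrt (dG 0)]. *)

Definition between (a b s : R) : Prop := Rmin a b <= s <= Rmax a b.

Lemma between_le (a b s : R) : a <= b -> between a b s <-> a <= s <= b.
Proof. intros H; unfold between; rewrite Rmin_left, Rmax_right; tauto. Qed.

Lemma between_sym (a b s : R) : between a b s <-> between b a s.
Proof. unfold between; rewrite (Rmin_comm a), (Rmax_comm a); tauto. Qed.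

Lemma between_ge (a b s : R) : b <= a -> between a b s <-> b <= s <= a.
Proof. intros H; rewrite between_sym; now apply between_le. Qed.

Lemma between_l (a b : R) : between a b a.
Proof. split; [apply Rmin_l | apply Rmax_l]. Qed.

Lemma between_r (a b : R) : between a b b.
Proof. split; [apply Rmin_r | apply Rmax_r]. Qed.

Lemma between_trans (a b s s' : R) : between a b s -> between a s s' -> between a b s'.
Proof.
  intros H H'; destruct (Rle_dec a b) as [L|L].
  - rewrite between_le in H by lra; rewrite between_le in H' by lra.
    apply between_le; lra.
  - rewrite between_ge in H by lra; rewrite between_ge in H' by lra.
    apply between_ge; lra.
Qed.

(** * Differentiation rules, mean values and intermediate values *)

Lemma deriv_eq (f : R -> R) (t l l' : R) : is_derive f t l -> l = l' -> is_derive f t l'.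
Proof. now intros H <-. Qed.

Lemma deriv_plus (f h : R -> R) (t a b : R) :
  is_derive f t a -> is_derive h t b -> is_derive (fun s => f s + h s) t (a + b).
Proof. intros; now apply @is_derive_plus. Qed.

Lemma deriv_minus (f h : R -> R) (t a b : R) :
  is_derive f t a -> is_derive h t b -> is_derive (fun s => f s - h s) t (a - b).
Proof. intros; now apply @is_derive_minus. Qed.

Lemma deriv_opp (f : R -> R) (t a : R) :
  is_derive f t a -> is_derive (fun s => - f s) t (- a).
Proof. intros; now apply @is_derive_opp. Qed.

Lemma deriv_mult (f h : R -> R) (t a b : R) :
  is_derive f t a -> is_derive h t b -> is_derive (fun s => f s * h s) t (a * h t + f t * b).
Proof. intros; apply @is_derive_mult; try assumption; apply Rmult_comm. Qed.

Lemma deriv_sqr (f : R -> R) (t a : R) :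
  is_derive f t a -> is_derive (fun s => f s ^ 2) t (2 * a * f t).
Proof.
  intros H; apply (is_derive_ext (fun s => f s * f s)).
  { intros s; change (f s * f s = f s ^ 2); ring. }
  eapply deriv_eq; [apply deriv_mult; eassumption | ring].
Qed.

Lemma deriv_comp (f h : R -> R) (t a b : R) :
  is_derive f (h t) a -> is_derive h t b -> is_derive (fun s => f (h s)) t (b * a).
Proof. intros Hf Hh; now apply @is_derive_comp. Qed.

Lemma deriv_exp (h : R -> R) (t b : R) :
  is_derive h t b -> is_derive (fun s => exp (h s)) t (b * exp (h t)).
Proof. intros H; apply deriv_comp; [apply is_derive_exp | exact H]. Qed.

Lemma deriv_const (c t : R) : is_derive (fun _ : R => c) t 0.
Proof. apply @is_derive_const. Qed.

Lemma deriv_id (t : R) : is_derive (fun s : R => s) t 1.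
Proof. apply @is_derive_id. Qed.

(* Plain [apply] or [eassumption] would unfold [is_derive] on a mismatch. *)
Ltac deriv_step :=
  lazymatch goal with
  | |- is_derive (fun _ => ?c) _ _ => apply deriv_const
  | |- is_derive (fun s => s) _ _ => apply deriv_id
  | |- is_derive (fun s => _ + _) _ _ => apply deriv_plus
  | |- is_derive (fun s => _ - _) _ _ => apply deriv_minus
  | |- is_derive (fun s => - _) _ _ => apply deriv_opp
  | |- is_derive (fun s => _ ^ 2) _ _ => apply deriv_sqr
  | |- is_derive (fun s => _ * _) _ _ => apply deriv_mult
  | |- is_derive (fun s => exp _) _ _ => apply deriv_exp
  | |- is_derive (Rmult ?c) ?t ?l => change (is_derive (fun s => c * s) t l)
  | |- is_derive (fun s => ?f s) ?t ?l => change (is_derive f t l)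
  | H : is_derive ?f ?t _ |- is_derive ?f ?t _ => exact H
  end.

Ltac deriv := eapply deriv_eq; [repeat deriv_step | cbv beta].

Lemma deriv_shift (f : R -> R) (c t a : R) :
  is_derive f (t + c) a -> is_derive (fun s => f (s + c)) t a.
Proof.
  intros H; eapply deriv_eq; [apply (deriv_comp f (fun s => s + c)); [exact H|deriv; reflexivity]|ring].
Qed.

Lemma deriv_reflect (f : R -> R) (c t a : R) :
  is_derive f (c - t) a -> is_derive (fun s => f (c - s)) t (- a).
Proof.
  intros H; eapply deriv_eq; [apply (deriv_comp f (fun s => c - s)); [exact H|deriv; reflexivity]|ring].
Qed.

Lemma deriv_continuity (f : R -> R) (t a : R) : is_derive f t a -> continuity_pt f t.
Proof.
  intros H; apply continuity_pt_filterlim, (ex_derive_continuous f); now exists a.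
Qed.

(** The endpoints come in either order, so that one statement serves both directions of time. *)
Lemma mvt (f df : R -> R) (a b : R) :
  (forall s, between a b s -> is_derive f s (df s)) ->
  exists c, between a b c /\ f b - f a = df c * (b - a).
Proof.
  intros H; apply MVT_gen.
  - intros s Hs; apply H; unfold between; lra.
  - intros s Hs; eapply deriv_continuity, H, Hs.
Qed.

Lemma constant_between (f df : R -> R) (a b : R) :
  (forall s, between a b s -> is_derive f s (df s) /\ df s = 0) -> f b = f a.
Proof.
  intros H; destruct (mvt f df a b) as [c [Hc E]]; [intros; now apply H|].
  destruct (H c Hc) as [_ Z]; rewrite Z in E; lra.
Qed.

(** The product form of the sign condition allows either order of the endpoints and either direction
    of crossing, zeros at the ends included. *)
Lemma ivt (f : R -> R) (a b y : R) :
  (forall s, between a b s -> continuity_pt f s) ->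
  (f a - y) * (f b - y) <= 0 -> exists c, between a b c /\ f c = y.
Proof.
  assert (W : forall (f : R -> R) a b, a < b -> (forall s, a <= s <= b -> continuity_pt f s) ->
     f a * f b <= 0 -> exists c, a <= c <= b /\ f c = 0).
  { clear; intros f a b L C P.
    destruct (Req_dec (f a) 0) as [Ea|Na]; [exists a; split; [lra|auto]|].
    destruct (Req_dec (f b) 0) as [Eb|Nb]; [exists b; split; [lra|auto]|].
    destruct (Rlt_dec (f a) 0) as [La|La].
    - destruct (IVT_interv f a b C L La) as [c [Hc E]]; [nra|now exists c].
    - destruct (IVT_interv (fun s => - f s) a b) as [c [Hc E]].
      + intros s Hs; apply continuity_pt_opp; now apply C.
      + exact L.
      + lra.
      + nra.
      + exists c; split; [easy|lra]. }
  intros C P.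
  assert (C' : forall s, between a b s -> continuity_pt (fun s => f s - y) s).
  { intros s Hs; apply continuity_pt_minus; [now apply C|].
    apply continuity_pt_const; intros ? ?; reflexivity. }
  destruct (Rtotal_order a b) as [L|[E|L]].
  - destruct (W (fun s => f s - y) a b L) as [c [Hc E]].
    + intros s Hs; apply C', between_le; lra.
    + exact P.
    + exists c; rewrite between_le by lra; split; lra.
  - exists a; split; [apply between_l|]. subst b; nra.
  - destruct (W (fun s => f s - y) b a L) as [c [Hc E]].
    + intros s Hs; apply C', between_ge; lra.
    + lra.
    + exists c; rewrite between_ge by lra; split; lra.
Qed.

(** * Second-order equations: estimates and existence *)

(** Adding [D / C] to [f] makes the affine bound linear. With [e] the sign of [t - t0], the weight
    [exp (- C * (e * (s - t0)))] then makes the product decrease away from [t0], forwards and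
    backwards alike. *)
Lemma gronwall (f df : R -> R) (C D t0 t : R) :
  0 < C ->
  (forall s, between t0 t s -> is_derive f s (df s) /\ Rabs (df s) <= C * f s + D) ->
  f t + D / C <= (f t0 + D / C) * exp (C * Rabs (t - t0)).
Proof.
  intros HC H.
  assert (K : forall e, e * (t - t0) = Rabs (t - t0) -> Rabs e = 1 ->
     f t + D / C <= (f t0 + D / C) * exp (C * Rabs (t - t0))).
  { intros e He Ae.
    destruct (mvt (fun s => (f s + D / C) * exp (- C * (e * (s - t0))))
        (fun s => (df s - C * e * (f s + D / C)) * exp (- C * (e * (s - t0)))) t0 t)
      as [c [Hc E]].
    { intros s Hs; destruct (H s Hs) as [Hd _]; deriv; ring. }
    destruct (H c Hc) as [_ B].
    assert (E2 : df c - C * e * (f c + D / C) = df c - e * (C * f c + D)) by (field; lra).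
    rewrite E2 in E.
    assert (N : (df c - e * (C * f c + D)) * (t - t0) <= 0).
    { apply Rabs_le_between in B.
      destruct (Rle_dec 0 (t - t0)) as [P|P].
      - rewrite Rabs_right in He by lra.
        destruct (Req_dec (t - t0) 0) as [Z|Z]; [rewrite Z; lra|].
        assert (e = 1) by nra; subst e; nra.
      - rewrite Rabs_left in He by lra.
        assert (e = -1) by nra; subst e; nra. }
    pose proof (exp_pos (- C * (e * (c - t0)))) as Pe.
    replace (t0 - t0) with 0 in E by ring.
    rewrite !Rmult_0_r, exp_0, He in E.
    assert (Q : (f t + D / C) * exp (- C * Rabs (t - t0)) <= f t0 + D / C) by nra.
    apply (Rmult_le_compat_r (exp (C * Rabs (t - t0)))) in Q; [|left; apply exp_pos].
    rewrite Rmult_assoc, <- exp_plus in Q.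
    replace (- C * Rabs (t - t0) + C * Rabs (t - t0)) with 0 in Q by ring.
    rewrite exp_0 in Q; lra. }
  destruct (Rle_dec 0 (t - t0)).
  - apply (K 1); [rewrite Rabs_right by lra; ring | apply Rabs_R1].
  - apply (K (-1)); [rewrite Rabs_left by lra; ring | rewrite Rabs_left; lra].
Qed.

(** Gronwall for [w ^ 2 + o ^ 2]: the inequality between products and squares splits
    [2 * O * ((1 + M) * W + D)] into the rate [2 + M] and the source [D ^ 2]. Leaving [z] free lets
    the bound serve solutions, their differences and linearization errors. *)
Lemma second_order_bound (w o z : R -> R) (M D t0 t : R) :
  0 <= M ->
  (forall s, between t0 t s ->
     is_derive w s (o s) /\ is_derive o s (z s) /\ Rabs (z s) <= M * Rabs (w s) + D) ->
  w t ^ 2 + o t ^ 2 <= (w t0 ^ 2 + o t0 ^ 2 + D ^ 2) * exp ((2 + M) * Rabs (t - t0)).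
Proof.
  intros HM H.
  assert (G : (w t ^ 2 + o t ^ 2) + D ^ 2 / (2 + M)
      <= ((w t0 ^ 2 + o t0 ^ 2) + D ^ 2 / (2 + M)) * exp ((2 + M) * Rabs (t - t0))).
  { apply (gronwall (fun s => w s ^ 2 + o s ^ 2) (fun s => 2 * o s * (w s + z s))); [lra|].
    intros s Hs; destruct (H s Hs) as [H1 [H2 H3]]; split; [deriv; ring|].
    rewrite !Rabs_mult, (Rabs_right 2) by lra.
    pose proof (Rabs_triang (w s) (z s)) as T.
    rewrite <- (pow2_abs (w s)), <- (pow2_abs (o s)).
    pose proof (Rabs_pos (w s)); pose proof (Rabs_pos (o s)).
    set (W := Rabs (w s)) in *; set (O := Rabs (o s)) in *.
    assert (B : Rabs (w s + z s) <= (1 + M) * W + D) by lra.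
    apply Rle_trans with (2 * O * ((1 + M) * W + D)).
    - apply Rmult_le_compat_l; lra.
    - assert (0 <= (1 + M) * (W - O) ^ 2) by (apply Rmult_le_pos; [lra | apply pow2_ge_0]).
      pose proof (pow2_ge_0 (O - D)); nra. }
  assert (P : 0 <= D ^ 2 / (2 + M)).
  { apply Rdiv_le_0_compat; [apply pow2_ge_0 | lra]. }
  assert (Q : D ^ 2 / (2 + M) <= D ^ 2).
  { apply Rle_div_l; [lra|]. pose proof (pow2_ge_0 D); nra. }
  pose proof (exp_pos ((2 + M) * Rabs (t - t0))).
  nra.
Qed.

Lemma exp_monotone (a b : R) : a <= b -> exp a <= exp b.
Proof. intros [L|E]; [left; now apply exp_increasing | right; now f_equal]. Qed.

Lemma continuous_RInt_deriv (f : R -> R) :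
  (forall s, continuous f s) -> forall a t, is_derive (RInt f a) t (f t).
Proof.
  intros C a t; apply (is_derive_RInt f (RInt f a) a t); [|apply C].
  apply filter_forall; intros s; apply (@RInt_correct R_CompleteNormedModule).
  apply (@ex_RInt_continuous R_CompleteNormedModule); intros; apply C.
Qed.

Lemma deriv_continuous (f : R -> R) (t a : R) : is_derive f t a -> continuous f t.
Proof. intros H; apply (ex_derive_continuous f); now exists a. Qed.

(** In the sup norm weighted by [exp (l * Rabs t)], one integration from [0] gains the factor
    [1 / l]. This is the source of the contraction below. *)
Lemma exp_growth_bound (f df : R -> R) (K l : R) :
  0 < l -> f 0 = 0 -> (forall s, is_derive f s (df s)) ->
  (forall s, Rabs (df s) <= K * exp (l * Rabs s)) ->
  forall t, Rabs (f t) <= K / l * exp (l * Rabs t).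
Proof.
  intros Hl Z Hd B t.
  assert (HK : 0 <= K).
  { specialize (B 0); rewrite Rabs_R0, Rmult_0_r, exp_0 in B.
    pose proof (Rabs_pos (df 0)); lra. }
  assert (W : forall h dh : R -> R, h 0 = 0 ->
     (forall s, is_derive h s (dh s)) -> (forall s, Rabs (dh s) <= K * exp (l * Rabs s)) ->
     forall t, 0 <= t -> h t <= K / l * exp (l * t)).
  { clear - Hl HK; intros h dh Z Hd B t Ht.
    destruct (mvt (fun s => h s - K / l * exp (l * s)) (fun s => dh s - K * exp (l * s)) 0 t)
      as [c [Hc E]].
    { intros s _; specialize (Hd s); deriv; field; lra. }
    rewrite between_le in Hc by lra.
    specialize (B c); apply Rabs_le_between in B; rewrite (Rabs_right c) in B by lra.
    rewrite Z, Rmult_0_r, exp_0 in E.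
    assert (0 <= K / l) by (apply Rdiv_le_0_compat; lra).
    nra. }
  assert (dO : forall s, is_derive (fun s => - f s) s (- df s)).
  { intros s; specialize (Hd s); deriv; ring. }
  assert (B' : forall s, Rabs (- df s) <= K * exp (l * Rabs s)).
  { intros s; rewrite Rabs_Ropp; apply B. }
  destruct (Rle_dec 0 t) as [P|P].
  - rewrite (Rabs_right t) by lra; apply Rabs_le; split.
    + pose proof (W (fun s => - f s) (fun s => - df s) ltac:(lra) dO B' t P); simpl in *; lra.
    + now apply (W f df).
  - rewrite (Rabs_left t) by lra.
    assert (R0 : forall h dh : R -> R, (forall s, is_derive h s (dh s)) ->
       forall s, is_derive (fun s => h (0 - s)) s (- dh (0 - s))).
    { intros h dh Hh s; apply deriv_reflect, Hh. }
    assert (B2 : forall dh : R -> R, (forall s, Rabs (dh s) <= K * exp (l * Rabs s)) ->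
       forall s, Rabs (- dh (0 - s)) <= K * exp (l * Rabs s)).
    { intros dh Hh s; rewrite Rabs_Ropp; replace (Rabs s) with (Rabs (0 - s)); [apply Hh|].
      rewrite <- (Rabs_Ropp s); f_equal; ring. }
    assert (Z0 : 0 - 0 = 0) by ring.
    pose proof (W (fun s => f (0 - s)) (fun s => - df (0 - s)) ltac:(cbv beta; rewrite Z0; exact Z) (R0 _ _ Hd) (B2 _ B) (- t) ltac:(lra)) as I1.
    pose proof (W (fun s => - f (0 - s)) (fun s => - - df (0 - s)) ltac:(cbv beta; rewrite Z0; lra) (R0 _ _ dO) (B2 _ B') (- t) ltac:(lra)) as I2.
    cbv beta in I1, I2; replace (0 - - t) with t in * by ring.
    apply Rabs_le; lra.
Qed.

(** Picard iteration for the twice integrated equation. The weighted norm yields a solution on the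
    whole line at once, without continuation of local solutions. *)
Lemma second_order_exists (F : R -> R -> R) (M x0 u0 : R) :
  0 <= M -> (forall t, F t 0 = 0) ->
  (forall t a b, Rabs (F t a - F t b) <= M * Rabs (a - b)) ->
  (forall x : R -> R, (forall t, continuous x t) ->
     forall t, continuous (fun s => F s (x s)) t) ->
  exists x u : R -> R, x 0 = x0 /\ u 0 = u0 /\
    forall t, is_derive x t (u t) /\ is_derive u t (F t (x t)).
Proof.
  intros HM F0 FL FC.
  set (Pu := fun (x : R -> R) t => u0 + RInt (fun s => F s (x s)) 0 t).
  set (P := fun (x : R -> R) t => x0 + RInt (Pu x) 0 t).
  assert (dPu : forall x : R -> R, (forall t, continuous x t) ->
     forall t, is_derive (Pu x) t (F t (x t))).
  { intros x Hx t; unfold Pu.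
    pose proof (continuous_RInt_deriv _ (FC x Hx) 0 t); deriv; ring. }
  assert (dP : forall x : R -> R, (forall t, continuous x t) ->
     forall t, is_derive (P x) t (Pu x t)).
  { intros x Hx t; unfold P.
    assert (C : forall s, continuous (Pu x) s) by (intros s; eapply deriv_continuous, dPu, Hx).
    pose proof (continuous_RInt_deriv _ C 0 t); deriv; ring. }
  assert (Pu0 : forall x, Pu x 0 = u0).
  { intros x; unfold Pu; rewrite RInt_point; apply Rplus_0_r. }
  assert (P0 : forall x, P x 0 = x0).
  { intros x; unfold P; rewrite RInt_point; apply Rplus_0_r. }
  (* With this growth rate, [P] contracts the weighted sup norm by the factor [1/2]. *)
  set (l := 1 + 2 * M).
  assert (contr : forall (x y : R -> R) K, (forall t, continuous x t) -> (forall t, continuous y t) ->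
     (forall t, Rabs (x t - y t) <= K * exp (l * Rabs t)) ->
     forall t, Rabs (P x t - P y t) <= K / 2 * exp (l * Rabs t)).
  { intros x y K Cx Cy B t.
    assert (HK : 0 <= K).
    { specialize (B 0); rewrite Rabs_R0, Rmult_0_r, exp_0 in B.
      pose proof (Rabs_pos (x 0 - y 0)); lra. }
    assert (B1 : forall t, Rabs (Pu x t - Pu y t) <= M * K / l * exp (l * Rabs t)).
    { apply (exp_growth_bound (fun t => Pu x t - Pu y t) (fun t => F t (x t) - F t (y t))).
      - unfold l; lra.
      - rewrite !Pu0; ring.
      - intros s; pose proof (dPu x Cx s); pose proof (dPu y Cy s); deriv; ring.
      - intros s; eapply Rle_trans; [apply FL|]. rewrite Rmult_assoc.
        apply Rmult_le_compat_l; auto. }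
    eapply Rle_trans.
    - apply (exp_growth_bound (fun t => P x t - P y t) (fun t => Pu x t - Pu y t) (M * K / l) l).
      + unfold l; lra.
      + rewrite !P0; ring.
      + intros s; pose proof (dP x Cx s); pose proof (dP y Cy s); deriv; ring.
      + apply B1.
    - apply Rmult_le_compat_r; [left; apply exp_pos|].
      assert (0 < l) by (unfold l; lra).
      apply Rle_div_l; [lra|]. apply Rle_div_l; [lra|].
      assert (2 * M <= l * l) by (unfold l; nra). nra. }
  set (X := fun n => Nat.iter n P (fun _ => 0)).
  assert (CX : forall n t, continuous (X n) t).
  { induction n as [|n IH]; intros t; [apply continuous_const|].
    eapply deriv_continuous, (dP (X n)), IH. }
  set (A := Rabs x0 + Rabs u0).
  assert (HA : 0 <= A) by (unfold A; pose proof (Rabs_pos x0); pose proof (Rabs_pos u0); lra).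
  assert (step : forall n t, Rabs (X (S n) t - X n t) <= A * (1 / 2) ^ n * exp (l * Rabs t)).
  { induction n as [|n IH]; intros t.
    (* Because [F] vanishes at [0], iterating from the zero function makes the first iterate the
       straight line [x0 + t * u0], whose growth is below the weight. *)
    - assert (E : X 1%nat t = x0 + t * u0).
      { unfold X; simpl; unfold P.
        rewrite (RInt_ext _ (fun _ => u0)).
        - rewrite RInt_const; change (x0 + (t - 0) * u0 = x0 + t * u0); ring.
        - intros s _; unfold Pu. rewrite (RInt_ext _ (fun _ => 0)) by (intros; apply F0).
          rewrite RInt_const; change (u0 + (s - 0) * 0 = u0); ring. }
      rewrite E; unfold X; simpl Nat.iter; rewrite pow_O, Rminus_0_r, Rmult_1_r.
      assert (E1 : 1 + Rabs t <= exp (l * Rabs t)).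
      { apply Rle_trans with (1 + l * Rabs t); [|apply exp_ineq1_le].
        pose proof (Rabs_pos t); unfold l; nra. }
      eapply Rle_trans; [apply Rabs_triang|]. rewrite Rabs_mult.
      pose proof (Rabs_pos t); pose proof (Rabs_pos x0); pose proof (Rabs_pos u0).
      unfold A; nra.
    - eapply Rle_trans; [apply (contr (X (S n)) (X n) (A * (1 / 2) ^ n)); auto|].
      right; simpl; field. }
  assert (dist : forall n k t, Rabs (X (n + k)%nat t - X n t)
       <= 2 * A * (1 / 2) ^ n * (1 - (1 / 2) ^ k) * exp (l * Rabs t)).
  { intros n k t; induction k as [|k IH].
    - rewrite Nat.add_0_r, Rminus_diag, Rabs_R0; simpl; lra.
    - rewrite Nat.add_succ_r.
      replace (X (S (n + k)) t - X n t)
        with ((X (S (n + k)) t - X (n + k)%nat t) + (X (n + k)%nat t - X n t)) by ring.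
      eapply Rle_trans; [apply Rabs_triang|].
      eapply Rle_trans; [apply Rplus_le_compat; [apply step | apply IH]|].
      rewrite pow_add; right; simpl; field. }
  assert (half : forall e, 0 < e -> exists N, forall n, (N <= n)%nat -> (1 / 2) ^ n < e).
  { intros e He; destruct (pow_lt_1_zero (1 / 2)) with (y := e) as [N HN]; auto.
    - rewrite Rabs_right; lra.
    - exists N; intros n Hn; specialize (HN n Hn).
      rewrite Rabs_right in HN; auto. apply Rle_ge, pow_le; lra. }
  assert (half_pos : forall n, 0 < (1 / 2) ^ n) by (intros; apply pow_lt; lra).
  set (x := fun t => real (Lim_seq (fun n => X n t))).
  assert (lim : forall t, is_lim_seq (fun n => X n t) (x t)).
  { intros t; apply Lim_seq_correct', ex_lim_seq_cauchy_corr; intros eps.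
    set (K := 2 * A * exp (l * Rabs t) + 1).
    assert (HK : 0 < K).
    { unfold K; pose proof (exp_pos (l * Rabs t)); nra. }
    assert (W : exists N, forall n k, (N <= n)%nat -> Rabs (X (n + k)%nat t - X n t) < eps).
    { destruct (half (eps / K)) as [N HN].
      - apply Rdiv_lt_0_compat; [apply cond_pos | exact HK].
      - exists N; intros n k Hn; eapply Rle_lt_trans; [apply dist|].
        specialize (HN n Hn); apply Rlt_div_r in HN; [|exact HK].
        pose proof (half_pos n); pose proof (half_pos k); pose proof (exp_pos (l * Rabs t)).
        eapply Rle_lt_trans; [|exact HN]; unfold K.
        assert (0 <= 2 * A * exp (l * Rabs t)) by nra.
        assert (0 <= 2 * A * exp (l * Rabs t) * (1 / 2) ^ n) by nra.
        nra. }
    destruct W as [N HN]; exists N; intros n m Hn Hm.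
    destruct (Nat.le_ge_cases n m) as [L|L].
    - replace m with (n + (m - n))%nat by lia.
      rewrite Rabs_minus_sym; now apply HN.
    - replace n with (m + (n - m))%nat by lia. now apply HN. }
  assert (near : forall n t, Rabs (x t - X n t) <= 2 * A * (1 / 2) ^ n * exp (l * Rabs t)).
  { intros n t.
    assert (L : is_lim_seq (fun k => Rabs (X (k + n)%nat t - X n t)) (Rabs (x t - X n t))).
    { assert (L1 : is_lim_seq (fun k => X (k + n)%nat t) (x t)).
      { exact (proj1 (is_lim_seq_incr_n (fun k => X k t) n (x t)) (lim t)). }
      apply (is_lim_seq_abs _ (x t - X n t)).
      apply (is_lim_seq_minus _ _ (x t) (X n t)); [exact L1 | apply is_lim_seq_const | reflexivity]. }
    refine (is_lim_seq_le _ _ _ _ _ L (is_lim_seq_const _)).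
    intros k; cbv beta; rewrite Nat.add_comm; eapply Rle_trans; [apply dist|].
    pose proof (half_pos n); pose proof (half_pos k); pose proof (exp_pos (l * Rabs t)).
    assert (0 <= 2 * A * (1 / 2) ^ n) by nra.
    apply Rmult_le_compat_r; [lra|]. nra. }
  (* Convergence is uniform only on bounded sets, where the weight is bounded; a ball reaching past
     [t] is enough. *)
  assert (Cx : forall t, continuous x t).
  { intros t; apply continuity_pt_filterlim.
    assert (Hr : 0 < Rabs t + 1) by (pose proof (Rabs_pos t); lra).
    apply (CVU_continuity X x 0 (mkposreal _ Hr)).
    - intros eps He.
      set (K := 2 * A * exp (l * (Rabs t + 1)) + 1).
      assert (HK : 0 < K).
      { unfold K; pose proof (exp_pos (l * (Rabs t + 1))); nra. }
      destruct (half (eps / K)) as [N HN]; [now apply Rdiv_lt_0_compat|].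
      exists N; intros n y Hn Hy; eapply Rle_lt_trans; [apply near|].
      specialize (HN n Hn); apply Rlt_div_r in HN; [|exact HK].
      unfold Boule in Hy; simpl in Hy; rewrite Rminus_0_r in Hy.
      assert (E : exp (l * Rabs y) <= exp (l * (Rabs t + 1))).
      { apply exp_monotone, Rmult_le_compat_l; [unfold l|]; lra. }
      pose proof (half_pos n).
      eapply Rle_lt_trans; [|exact HN]; unfold K.
      assert (0 <= 2 * A * (1 / 2) ^ n) by nra. nra.
    - intros n y _; apply continuity_pt_filterlim, CX.
    - unfold Boule; simpl; rewrite Rminus_0_r; lra. }
  assert (fix_x : forall t, P x t = x t).
  { intros t.
    assert (B : forall n, Rabs (P x t - x t) <= 2 * A * exp (l * Rabs t) * (1 / 2) ^ n).
    { intros n; replace (P x t - x t) with ((P x t - X (S n) t) + - (x t - X (S n) t)) by ring.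
      eapply Rle_trans; [apply Rabs_triang|]. rewrite Rabs_Ropp.
      pose proof (near (S n) t) as B1.
      pose proof (contr x (X n) (2 * A * (1 / 2) ^ n) Cx (CX n) (near n) t) as B2.
      change (P (X n) t) with (X (S n) t) in B2; simpl pow in B1; lra. }
    destruct (Req_dec (P x t) (x t)) as [E|E]; [exact E|exfalso].
    assert (Hp : 0 < Rabs (P x t - x t)) by (apply Rabs_pos_lt; lra).
    set (K := 2 * A * exp (l * Rabs t) + 1).
    assert (HK : 0 < K).
    { unfold K; pose proof (exp_pos (l * Rabs t)); nra. }
    destruct (half (Rabs (P x t - x t) / K)) as [N HN]; [now apply Rdiv_lt_0_compat|].
    specialize (HN N (le_n N)); apply Rlt_div_r in HN; [|exact HK].
    specialize (B N); pose proof (half_pos N); unfold K in HN; nra. }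
  exists x, (Pu x); split; [|split].
  - rewrite <- fix_x; apply P0.
  - apply Pu0.
  - intros t; split; [|now apply dPu].
    apply (is_derive_ext (P x)); [exact fix_x | now apply dP].
Qed.

(** The forces [z1] and [z2] are compared only along the two given solutions, so a solution of the
    local equation can be compared with one of the extended equation. *)
Lemma second_order_close (x1 u1 z1 x2 u2 z2 : R -> R) (M t0 t : R) :
  0 <= M ->
  (forall s, between t0 t s ->
     (is_derive x1 s (u1 s) /\ is_derive u1 s (z1 s)) /\
     (is_derive x2 s (u2 s) /\ is_derive u2 s (z2 s)) /\
     Rabs (z1 s - z2 s) <= M * Rabs (x1 s - x2 s)) ->
  (x1 t - x2 t) ^ 2 + (u1 t - u2 t) ^ 2
  <= ((x1 t0 - x2 t0) ^ 2 + (u1 t0 - u2 t0) ^ 2) * exp ((2 + M) * Rabs (t - t0)).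
Proof.
  intros HM H.
  pose proof (second_order_bound (fun s => x1 s - x2 s) (fun s => u1 s - u2 s)
    (fun s => z1 s - z2 s) M 0 t0 t HM) as B; cbv beta in B.
  replace (0 ^ 2) with 0 in B by ring; rewrite Rplus_0_r in B.
  apply B; intros s Hs; destruct (H s Hs) as [[] [[] ?]].
  split; [deriv; ring|split; [deriv; ring | lra]].
Qed.

Lemma second_order_unique (x1 u1 z1 x2 u2 z2 : R -> R) (M t0 t : R) :
  0 <= M ->
  (forall s, between t0 t s ->
     (is_derive x1 s (u1 s) /\ is_derive u1 s (z1 s)) /\
     (is_derive x2 s (u2 s) /\ is_derive u2 s (z2 s)) /\
     Rabs (z1 s - z2 s) <= M * Rabs (x1 s - x2 s)) ->
  x1 t0 = x2 t0 -> u1 t0 = u2 t0 -> x1 t = x2 t /\ u1 t = u2 t.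
Proof.
  intros HM H Ex Eu.
  pose proof (second_order_close _ _ _ _ _ _ M t0 t HM H) as B.
  rewrite Ex, Eu, !Rminus_diag in B.
  pose proof (pow2_ge_0 (x1 t - x2 t)); pose proof (pow2_ge_0 (u1 t - u2 t)).
  split; apply Rminus_diag_uniq, Rsqr_0_uniq; unfold Rsqr; simpl in *; nra.
Qed.

(** * Linear equations of second order *)

Definition lin (q y v : R -> R) : Prop :=
  forall t, is_derive y t (v t) /\ is_derive v t (- q t * y t).

Lemma lin_unique (q y1 v1 y2 v2 : R -> R) (M t0 : R) :
  (forall t, Rabs (q t) <= M) -> lin q y1 v1 -> lin q y2 v2 ->
  y1 t0 = y2 t0 -> v1 t0 = v2 t0 -> forall t, y1 t = y2 t /\ v1 t = v2 t.
Proof.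
  intros Hq H1 H2 Ey Ev t.
  apply (second_order_unique y1 v1 (fun s => - q s * y1 s) y2 v2 (fun s => - q s * y2 s) M t0);
    [pose proof (Rabs_pos (q 0)); specialize (Hq 0); lra | | exact Ey | exact Ev].
  intros s _; split; [apply H1|split; [apply H2|]].
  replace (- q s * y1 s - - q s * y2 s) with (- (q s * (y1 s - y2 s))) by ring.
  rewrite Rabs_Ropp, Rabs_mult; apply Rmult_le_compat_r; [apply Rabs_pos | apply Hq].
Qed.

Lemma lin_comb (q y1 v1 y2 v2 : R -> R) (a b : R) :
  lin q y1 v1 -> lin q y2 v2 ->
  lin q (fun t => a * y1 t + b * y2 t) (fun t => a * v1 t + b * v2 t).
Proof.
  intros H1 H2 t; destruct (H1 t), (H2 t); split; deriv; ring.
Qed.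

Lemma lin_shift (q y v : R -> R) (c : R) :
  (forall t, q (t + c) = q t) -> lin q y v ->
  lin q (fun t => y (t + c)) (fun t => v (t + c)).
Proof.
  intros Hq H t; destruct (H (t + c)); split.
  - now apply deriv_shift.
  - rewrite <- Hq; now apply (deriv_shift v).
Qed.

Lemma lin_reflect (q y v : R -> R) :
  (forall t, q (0 - t) = q t) -> lin q y v ->
  lin q (fun t => y (0 - t)) (fun t => - v (0 - t)).
Proof.
  intros Hq H t; destruct (H (0 - t)) as [H1 H2]; split.
  - now apply deriv_reflect.
  - apply deriv_reflect in H2; rewrite <- (Hq t); deriv; ring.
Qed.

(* Satisfied by an extension of the force to the whole line from a small neighbourhood of [0].
   The time between two consecutive rests of any orbit then lies in [PI / sqrt M, PI / sqrt m],
   and [M < 4 * m] prevents confusing one such time with two. *)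
Record tame (G dG : R -> R) (m M : R) : Prop := {
  tame_pos : 0 < m;
  tame_ratio : m <= M < 4 * m;
  tame_zero : G 0 = 0;
  tame_deriv : forall s, is_derive G s (dG s);
  tame_bounds : forall s, m <= dG s <= M;
  tame_uniform : forall e, 0 < e -> exists d, 0 < d /\
    forall a b, Rabs (a - b) < d -> Rabs (dG a - dG b) < e }.

(** * Global oscillators and the symmetries of their orbits *)

Definition osc (G x u : R -> R) : Prop :=
  forall t, is_derive x t (u t) /\ is_derive u t (- G (x t)).

Lemma tame_abs G dG m M (H : tame G dG m M) (s : R) : Rabs (dG s) <= M.
Proof.
  pose proof (tame_bounds _ _ _ _ H s); pose proof (tame_pos _ _ _ _ H).
  rewrite Rabs_right; lra.
Qed.

Lemma tame_M_pos G dG m M (H : tame G dG m M) : 0 < M.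
Proof. pose proof (tame_pos _ _ _ _ H); pose proof (tame_ratio _ _ _ _ H); lra. Qed.

Lemma tame_mean G dG m M (H : tame G dG m M) (a b : R) :
  exists c, between a b c /\ G b - G a = dG c * (b - a).
Proof. apply (mvt G dG); intros; apply (tame_deriv _ _ _ _ H). Qed.

Lemma tame_lip G dG m M (H : tame G dG m M) (a b : R) :
  Rabs (- G a - - G b) <= M * Rabs (a - b).
Proof.
  destruct (tame_mean _ _ _ _ H a b) as [c [_ E]].
  replace (- G a - - G b) with (dG c * (b - a)) by lra.
  rewrite Rabs_mult, (Rabs_minus_sym b a).
  apply Rmult_le_compat_r; [apply Rabs_pos | apply (tame_abs _ _ _ _ H)].
Qed.

(** Squeezes the force between two linear restoring forces, which gives its sign and its size
    together. *)
Lemma tame_slope G dG m M (H : tame G dG m M) (s : R) :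
  exists k, m <= k <= M /\ G s = k * s.
Proof.
  destruct (tame_mean _ _ _ _ H 0 s) as [c [_ E]].
  exists (dG c); split; [apply (tame_bounds _ _ _ _ H)|].
  rewrite (tame_zero _ _ _ _ H) in E; lra.
Qed.

Lemma tame_deriv_continuous G dG m M (H : tame G dG m M) (s : R) : continuous dG s.
Proof.
  apply continuity_pt_filterlim; unfold continuity_pt, continue_in, limit1_in, limit_in; intros e He.
  destruct (tame_uniform _ _ _ _ H e He) as [d [Hd B]].
  exists d; split; [exact Hd|]; intros s' [_ Hs]; now apply B.
Qed.

Lemma tame_continuous G dG m M (H : tame G dG m M) (s : R) : continuous G s.
Proof. eapply deriv_continuous, (tame_deriv _ _ _ _ H). Qed.

Lemma osc_exists G dG m M (H : tame G dG m M) (x0 u0 : R) :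
  exists x u, osc G x u /\ x 0 = x0 /\ u 0 = u0.
Proof.
  destruct (second_order_exists (fun _ a => - G a) M x0 u0) as [x [u [Hx [Hu E]]]].
  - left; apply (tame_M_pos _ _ _ _ H).
  - intros _; rewrite (tame_zero _ _ _ _ H); ring.
  - intros _; apply (tame_lip _ _ _ _ H).
  - intros x Hx t; apply (continuous_opp (fun s => G (x s))).
    apply continuous_comp; [apply Hx | apply (tame_continuous _ _ _ _ H)].
  - now exists x, u.
Qed.

Lemma lin_exists G dG m M (H : tame G dG m M) (x u : R -> R) (y0 v0 : R) :
  osc G x u -> exists y v, lin (fun t => dG (x t)) y v /\ y 0 = y0 /\ v 0 = v0.
Proof.
  intros Hx.
  destruct (second_order_exists (fun t a => - dG (x t) * a) M y0 v0) as [y [v [Hy [Hv E]]]].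
  - left; apply (tame_M_pos _ _ _ _ H).
  - intros t; ring.
  - intros t a b; replace (- dG (x t) * a - - dG (x t) * b) with (- (dG (x t) * (a - b))) by ring.
    rewrite Rabs_Ropp, Rabs_mult.
    apply Rmult_le_compat_r; [apply Rabs_pos | apply (tame_abs _ _ _ _ H)].
  - intros y Hy t; apply (continuous_mult (fun s => - dG (x s)) y); [|apply Hy].
    apply (continuous_opp (fun s => dG (x s))), continuous_comp;
      [eapply deriv_continuous, Hx | apply (tame_deriv_continuous _ _ _ _ H)].
  - now exists y, v.
Qed.

Lemma osc_close G dG m M (H : tame G dG m M) (x1 u1 x2 u2 : R -> R) (t0 t : R) :
  osc G x1 u1 -> osc G x2 u2 ->
  (x1 t - x2 t) ^ 2 + (u1 t - u2 t) ^ 2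
  <= ((x1 t0 - x2 t0) ^ 2 + (u1 t0 - u2 t0) ^ 2) * exp ((2 + M) * Rabs (t - t0)).
Proof.
  intros H1 H2.
  apply second_order_close with (fun s => - G (x1 s)) (fun s => - G (x2 s)).
  - left; apply (tame_M_pos _ _ _ _ H).
  - intros s _; split; [apply H1|split; [apply H2 | apply (tame_lip _ _ _ _ H)]].
Qed.

Lemma osc_unique G dG m M (H : tame G dG m M) (x1 u1 x2 u2 : R -> R) (t0 : R) :
  osc G x1 u1 -> osc G x2 u2 -> x1 t0 = x2 t0 -> u1 t0 = u2 t0 ->
  forall t, x1 t = x2 t /\ u1 t = u2 t.
Proof.
  intros H1 H2 Ex Eu t.
  apply second_order_unique with (fun s => - G (x1 s)) (fun s => - G (x2 s)) M t0; auto.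
  - left; apply (tame_M_pos _ _ _ _ H).
  - intros s _; split; [apply H1|split; [apply H2 | apply (tame_lip _ _ _ _ H)]].
Qed.

Lemma osc_shift G x u c : osc G x u -> osc G (fun t => x (t + c)) (fun t => u (t + c)).
Proof.
  intros H t; destruct (H (t + c)); split.
  - now apply deriv_shift.
  - now apply (deriv_shift u).
Qed.

Lemma osc_reflect G x u c : osc G x u -> osc G (fun t => x (c - t)) (fun t => - u (c - t)).
Proof.
  intros H t; destruct (H (c - t)) as [H1 H2]; split.
  - now apply deriv_reflect.
  - apply deriv_reflect in H2; deriv; ring.
Qed.

Lemma osc_zero G dG m M (H : tame G dG m M) : osc G (fun _ => 0) (fun _ => 0).
Proof. intros t; split; deriv; [ring|]; rewrite (tame_zero _ _ _ _ H); ring. Qed.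

(** The equation is autonomous, so the velocity is the variational solution belonging to time
    translation. The gain of [y] over a period is measured against it. *)
Lemma osc_lin G dG m M (H : tame G dG m M) x u :
  osc G x u -> lin (fun t => dG (x t)) u (fun t => - G (x t)).
Proof.
  intros Hx t; destruct (Hx t) as [H1 H2]; split; [exact H2|].
  pose proof (deriv_comp G x t _ _ (tame_deriv _ _ _ _ H (x t)) H1); deriv; ring.
Qed.

(** Reversibility: reflecting time about an instant of rest gives an orbit with the same data at
    that instant. *)
Lemma osc_symm G dG m M (H : tame G dG m M) x u c :
  osc G x u -> u c = 0 -> forall s, x (c + s) = x (c - s) /\ u (c + s) = - u (c - s).
Proof.
  intros Hx Hc s; rewrite (Rplus_comm c s).
  apply (osc_unique _ _ _ _ H (fun t => x (t + c)) (fun t => u (t + c))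
           (fun t => x (c - t)) (fun t => - u (c - t)) 0).
  - now apply osc_shift.
  - now apply osc_reflect.
  - rewrite Rplus_0_l, Rminus_0_r; reflexivity.
  - rewrite Rplus_0_l, Rminus_0_r, Hc; ring.
Qed.

(** The reflections about [0] and about [c] compose to the translation by [2 * c]. *)
Lemma osc_periodic G dG m M (H : tame G dG m M) x u c :
  osc G x u -> u 0 = 0 -> u c = 0 ->
  forall t, x (t + 2 * c) = x t /\ u (t + 2 * c) = u t.
Proof.
  intros Hx H0 Hc t.
  destruct (osc_symm _ _ _ _ H x u c Hx Hc (t + c)) as [E1 E2].
  destruct (osc_symm _ _ _ _ H x u 0 Hx H0 (- t)) as [E3 E4].
  replace (c + (t + c)) with (t + 2 * c) in * by ring.
  replace (c - (t + c)) with (0 + - t) in * by ring.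
  replace (0 - - t) with t in * by ring.
  split; lra.
Qed.

(** * Energy *)

Lemma V_deriv G dG m M (H : tame G dG m M) (s : R) : is_derive (V G) s (G s).
Proof. apply (continuous_RInt_deriv G); apply (tame_continuous _ _ _ _ H). Qed.

Lemma V_0 G : V G 0 = 0.
Proof. unfold V; rewrite RInt_point; reflexivity. Qed.

Lemma V_bounds G dG m M (H : tame G dG m M) (s : R) : m * s ^ 2 <= 2 * V G s <= M * s ^ 2.
Proof.
  (* The increment of [2 * V G s - k * s ^ 2] has the sign of [e - k], where [e] is a slope in
     [[m, M]]; the cases [k = m] and [k = M] are the two bounds. *)
  assert (W : forall k, exists c e, 0 <= c * s /\ m <= e <= M /\
     2 * V G s - k * s ^ 2 = 2 * (e - k) * (c * s)).
  { intros k.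
    destruct (mvt (fun s => 2 * V G s - k * s ^ 2) (fun s => 2 * (G s - k * s)) 0 s) as [c [Hc E]].
    { intros r _; pose proof (V_deriv _ _ _ _ H r); deriv; ring. }
    destruct (tame_slope _ _ _ _ H c) as [e [He Ee]].
    exists c, e; split; [|split; [exact He|]].
    - destruct (Rle_dec 0 s).
      + rewrite between_le in Hc by lra; nra.
      + rewrite between_ge in Hc by lra; nra.
    - rewrite V_0, Ee in E; lra. }
  destruct (W m) as [c [e [H1 [H2 H3]]]], (W M) as [c' [e' [H1' [H2' H3']]]].
  split; nra.
Qed.

Lemma V_increasing G dG m M (H : tame G dG m M) (a b : R) : 0 <= a < b -> V G a < V G b.
Proof.
  intros L.
  (* Two halves, because the force may vanish at the left end; strictness comes from the half away
     from it. *)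
  destruct (mvt (V G) G ((a + b) / 2) b) as [c [Hc E]]; [intros; apply (V_deriv _ _ _ _ H)|].
  destruct (mvt (V G) G a ((a + b) / 2)) as [d [Hd F]]; [intros; apply (V_deriv _ _ _ _ H)|].
  rewrite between_le in Hc, Hd by lra.
  destruct (tame_slope _ _ _ _ H c) as [k [Hk Ek]], (tame_slope _ _ _ _ H d) as [j [Hj Ej]].
  pose proof (tame_pos _ _ _ _ H).
  assert (0 < G c) by (rewrite Ek; apply Rmult_lt_0_compat; lra).
  assert (0 <= G d) by (rewrite Ej; apply Rmult_le_pos; lra).
  nra.
Qed.

Lemma V_decreasing G dG m M (H : tame G dG m M) (a b : R) : a < b <= 0 -> V G b < V G a.
Proof.
  intros L.
  destruct (mvt (V G) G a ((a + b) / 2)) as [c [Hc E]]; [intros; apply (V_deriv _ _ _ _ H)|].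
  destruct (mvt (V G) G ((a + b) / 2) b) as [d [Hd F]]; [intros; apply (V_deriv _ _ _ _ H)|].
  rewrite between_le in Hc, Hd by lra.
  destruct (tame_slope _ _ _ _ H c) as [k [Hk Ek]], (tame_slope _ _ _ _ H d) as [j [Hj Ej]].
  pose proof (tame_pos _ _ _ _ H).
  assert (G c < 0) by (rewrite Ek; nra).
  assert (G d <= 0) by (rewrite Ej; nra).
  nra.
Qed.

Lemma osc_energy G dG m M (H : tame G dG m M) x u t0 t :
  osc G x u -> u t ^ 2 + 2 * V G (x t) = u t0 ^ 2 + 2 * V G (x t0).
Proof.
  intros Hx.
  apply (constant_between (fun s => u s ^ 2 + 2 * V G (x s)) (fun _ => 0)).
  intros s _; split; [|reflexivity]; destruct (Hx s) as [H1 H2].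
  pose proof (deriv_comp _ _ _ _ _ (V_deriv _ _ _ _ H (x s)) H1); deriv; ring.
Qed.

(** * Turning times *)

Definition turn (u : R -> R) (t1 : R) : Prop :=
  0 < t1 /\ u t1 = 0 /\ forall s, 0 < s < t1 -> u s < 0.

Lemma turn_unique u t1 t2 : turn u t1 -> turn u t2 -> t1 = t2.
Proof.
  intros [P1 [Z1 N1]] [P2 [Z2 N2]].
  destruct (Rtotal_order t1 t2) as [L|[E|L]]; [|exact E|].
  - specialize (N2 t1); lra.
  - specialize (N1 t2); lra.
Qed.

Lemma turn_ext u u' t1 : (forall t, u t = u' t) -> turn u t1 -> turn u' t1.
Proof.
  intros E [P [Z N]]; split; [exact P|split; [now rewrite <- E|]].
  intros s Hs; rewrite <- E; auto.
Qed.

Lemma sin_deriv k t : is_derive (fun s => sin (k * s)) t (k * cos (k * t)).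
Proof. auto_derive; [exact I | ring]. Qed.

Lemma cos_deriv k t : is_derive (fun s => cos (k * s)) t (- k * sin (k * t)).
Proof. auto_derive; [exact I | ring]. Qed.

(* Sturm comparison of [u'' = - G'(x) u] with [sin (k t)], through their Wronskian. *)
Lemma wronskian G dG m M (H : tame G dG m M) x u k t :
  osc G x u -> u 0 = 0 -> 0 <= t ->
  exists c, 0 <= c <= t /\
    u t * (k * cos (k * t)) + G (x t) * sin (k * t)
    = (dG (x c) - k ^ 2) * u c * sin (k * c) * t.
Proof.
  intros Hx H0 Ht.
  destruct (mvt (fun s => u s * (k * cos (k * s)) + G (x s) * sin (k * s))
              (fun s => (dG (x s) - k ^ 2) * u s * sin (k * s)) 0 t) as [c [Hc E]].
  - intros s _; destruct (Hx s) as [H1 H2].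
    pose proof (deriv_comp G x s _ _ (tame_deriv _ _ _ _ H (x s)) H1).
    pose proof (sin_deriv k s); pose proof (cos_deriv k s); deriv; ring.
  - exists c; rewrite between_le in Hc by lra; split; [exact Hc|].
    rewrite H0, Rmult_0_r, sin_0 in E; lra.
Qed.

(** With [k = sqrt m], the left side of the Wronskian identity at [PI / sqrt m] is
    [- u * sqrt m > 0], while the right side is at most [0] if [u] has stayed negative. *)
Lemma sturm_upper G dG m M (H : tame G dG m M) x u :
  osc G x u -> u 0 = 0 -> (forall s, 0 < s <= PI / sqrt m -> u s < 0) -> False.
Proof.
  intros Hx H0 N.
  pose proof (tame_pos _ _ _ _ H) as Hm; pose proof PI_RGT_0 as HP.
  assert (Hk : 0 < sqrt m) by now apply sqrt_lt_R0.
  assert (Ht : 0 < PI / sqrt m) by now apply Rdiv_lt_0_compat.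
  destruct (wronskian _ _ _ _ H x u (sqrt m) (PI / sqrt m) Hx H0) as [c [Hc E]]; [lra|].
  replace (sqrt m * (PI / sqrt m)) with PI in E by (field; lra).
  rewrite cos_PI, sin_PI, pow2_sqrt in E by lra.
  specialize (N (PI / sqrt m) ltac:(lra)) as N1.
  assert (U : u c <= 0).
  { destruct (Req_dec c 0) as [->|Z]; [lra|]; left; apply N; lra. }
  assert (S : 0 <= sin (sqrt m * c)).
  { apply sin_ge_0; [apply Rmult_le_pos; lra|].
    apply Rle_trans with (sqrt m * (PI / sqrt m)); [apply Rmult_le_compat_l; lra|].
    right; field; lra. }
  pose proof (tame_bounds _ _ _ _ H (x c)).
  assert (0 <= (dG (x c) - m) * - u c * sin (sqrt m * c) * (PI / sqrt m)).
  { apply Rmult_le_pos; [apply Rmult_le_pos; [apply Rmult_le_pos|]|]; lra. }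
  assert (0 < - u (PI / sqrt m) * sqrt m) by (apply Rmult_lt_0_compat; lra).
  lra.
Qed.

(** Otherwise energy forces [x t1 = x 0]. As [x] does not increase in between, it would be constant,
    and at half time energy would give zero velocity. *)
Lemma turn_neg G dG m M (H : tame G dG m M) x u t1 :
  osc G x u -> 0 < x 0 -> u 0 = 0 -> turn u t1 -> x t1 < 0.
Proof.
  intros Hx P H0 [P1 [Z1 N1]].
  destruct (Rlt_dec (x t1) 0) as [L|L]; [exact L|exfalso].
  pose proof (osc_energy _ _ _ _ H x u 0 t1 Hx) as E; rewrite Z1, H0 in E.
  assert (E1 : x t1 = x 0).
  { destruct (Rtotal_order (x t1) (x 0)) as [B|[B|B]]; [|exact B|].
    - pose proof (V_increasing _ _ _ _ H (x t1) (x 0)); lra.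
    - pose proof (V_increasing _ _ _ _ H (x 0) (x t1)); lra. }
  destruct (mvt x u 0 (t1 / 2)) as [c [Hc Ec]]; [intros; apply Hx|].
  destruct (mvt x u (t1 / 2) t1) as [d [Hd Ed]]; [intros; apply Hx|].
  rewrite between_le in Hc, Hd by lra.
  assert (Uc : u c <= 0).
  { destruct (Req_dec c 0) as [->|]; [lra|]; left; apply N1; lra. }
  assert (Ud : u d <= 0).
  { destruct (Req_dec d t1) as [->|]; [lra|]; left; apply N1; lra. }
  assert (E2 : x (t1 / 2) = x 0) by nra.
  pose proof (osc_energy _ _ _ _ H x u 0 (t1 / 2) Hx) as E3; rewrite E2, H0 in E3.
  specialize (N1 (t1 / 2) ltac:(lra)); nra.
Qed.

(** With [k = sqrt M] and a turn before [PI / sqrt M], only [G (x t1) * sin (sqrt M * t1)] remains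
    on the left of the Wronskian identity. It is negative by [turn_neg], while the right side is
    nonnegative. *)
Lemma sturm_lower G dG m M (H : tame G dG m M) x u t1 :
  osc G x u -> 0 < x 0 -> u 0 = 0 -> turn u t1 -> PI / sqrt M <= t1.
Proof.
  intros Hx P H0 T.
  pose proof (turn_neg _ _ _ _ H x u t1 Hx P H0 T) as Neg.
  destruct T as [P1 [Z1 N1]].
  pose proof (tame_pos _ _ _ _ H) as Hm; pose proof (tame_M_pos _ _ _ _ H) as HM.
  assert (Hk : 0 < sqrt M) by now apply sqrt_lt_R0.
  destruct (Rle_dec (PI / sqrt M) t1) as [L|L]; [exact L|exfalso].
  assert (L' : sqrt M * t1 < PI).
  { apply Rnot_le_lt in L; apply Rlt_div_r in L; lra. }
  destruct (wronskian _ _ _ _ H x u (sqrt M) t1 Hx H0) as [c [Hc E]]; [lra|].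
  rewrite Z1, pow2_sqrt in E by lra.
  assert (U : u c <= 0).
  { destruct (Req_dec c 0) as [->|Z]; [lra|].
    destruct (Req_dec c t1) as [->|Z']; [lra|]; left; apply N1; lra. }
  assert (S : 0 <= sin (sqrt M * c)).
  { apply sin_ge_0; [apply Rmult_le_pos; lra|]. nra. }
  assert (S1 : 0 < sin (sqrt M * t1)) by (apply sin_gt_0; nra).
  destruct (tame_slope _ _ _ _ H (x t1)) as [k [Hk' Ek]].
  pose proof (tame_bounds _ _ _ _ H (x c)).
  assert (0 <= (M - dG (x c)) * - u c * sin (sqrt M * c) * t1).
  { repeat apply Rmult_le_pos; lra. }
  assert (0 < k * - x t1 * sin (sqrt M * t1)).
  { repeat apply Rmult_lt_0_compat; lra. }
  rewrite Ek in E; lra.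
Qed.

Lemma turn_exists G dG m M (H : tame G dG m M) x u :
  osc G x u -> 0 < x 0 -> u 0 = 0 -> exists t1, turn u t1 /\ t1 <= PI / sqrt m.
Proof.
  intros Hx P H0.
  pose proof (tame_pos _ _ _ _ H) as Hm.
  assert (Ub : forall t, (forall s, 0 < s < t -> u s < 0) -> t <= PI / sqrt m).
  { intros t N; destruct (Rle_dec t (PI / sqrt m)) as [L|L]; [exact L|exfalso].
    apply (sturm_upper _ _ _ _ H x u Hx H0); intros s Hs; apply N; lra. }
  (* The turning time is the supremum of the times up to which the velocity has stayed negative; the
     Sturm bound makes it finite. *)
  destruct (completeness (fun t => forall s, 0 < s < t -> u s < 0)) as [t1 [B1 B2]].
  - exists (PI / sqrt m); intros t N; now apply Ub.
  - exists 0; intros s Hs; lra.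
  - assert (N1 : forall s, 0 < s < t1 -> u s < 0).
    { intros s Hs.
      destruct (Rlt_dec (u s) 0) as [L|L]; [exact L|exfalso].
      assert (t1 <= s); [|lra].
      apply B2; intros t N; destruct (Rle_dec t s) as [Q|Q]; [exact Q|].
      specialize (N s); lra. }
    (* The acceleration at release is [- G (x 0) < 0], so the velocity is negative for a while. *)
    assert (P1 : 0 < t1).
    { destruct (Hx 0) as [H1 H2].
      assert (K : 0 < G (x 0)).
      { destruct (tame_slope _ _ _ _ H (x 0)) as [k [Hk ->]]; apply Rmult_lt_0_compat; lra. }
      assert (C : continuity_pt (fun s => - G (x s)) 0).
      { apply continuity_pt_filterlim, (continuous_opp (fun s => G (x s))).
        apply continuous_comp; [eapply deriv_continuous, Hx | apply (tame_continuous _ _ _ _ H)]. }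
      destruct (C (G (x 0)) K) as [d [Hd N]].
      assert (d <= t1); [|lra].
      apply B1; intros s Hs.
      destruct (mvt u (fun s => - G (x s)) 0 s) as [c [Hc E]]; [intros; apply Hx|].
      rewrite between_le in Hc by lra.
      assert (Gc : - G (x c) < 0).
      { destruct (Req_dec c 0) as [->|Z]; [lra|].
        assert (Q : Rabs (- G (x c) - - G (x 0)) < G (x 0)).
        { apply N; split; [split; [exact I|auto]|]. simpl; unfold R_dist.
          rewrite Rabs_right; lra. }
        apply Rabs_lt_between in Q; lra. }
      nra. }
    exists t1; split; [|now apply Ub].
    split; [exact P1|split; [|exact N1]].
    assert (C : continuity_pt u t1) by (eapply deriv_continuity, Hx).
    destruct (Rtotal_order (u t1) 0) as [L|[E|L]]; [exfalso|exact E|exfalso].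
    + destruct (C (- u t1) ltac:(lra)) as [d [Hd N]].
      assert (t1 + d <= t1); [|lra].
      apply B1; intros s Hs.
      destruct (Rlt_dec s t1) as [L1|L1]; [apply N1; lra|].
      destruct (Req_dec s t1) as [->|Z]; [exact L|].
      assert (Q : Rabs (u s - u t1) < - u t1).
      { apply N; split; [split; [exact I|auto]|]. simpl; unfold R_dist; rewrite Rabs_right; lra. }
      apply Rabs_lt_between in Q; lra.
    + destruct (C (u t1) L) as [d [Hd N]].
      set (s := Rmax (t1 / 2) (t1 - d / 2)).
      assert (Hs : t1 / 2 <= s /\ t1 - d / 2 <= s /\ s < t1).
      { unfold s; split; [apply Rmax_l|split; [apply Rmax_r|]]. apply Rmax_lub_lt; lra. }
      assert (Q : Rabs (u s - u t1) < u t1).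
      { apply N; split; [split; [exact I|lra]|]. simpl; unfold R_dist; rewrite Rabs_left; lra. }
      apply Rabs_lt_between in Q; specialize (N1 s); lra.
Qed.

(** Reflection about [t1] carries the second half period onto the first. *)
Lemma turn_only_zero G dG m M (H : tame G dG m M) x u t1 s :
  osc G x u -> turn u t1 -> 0 < s < 2 * t1 -> u s = 0 -> s = t1.
Proof.
  intros Hx [P1 [Z1 N1]] Hs Zs.
  destruct (Rtotal_order s t1) as [L|[E|L]]; [|exact E|].
  - specialize (N1 s); lra.
  - destruct (osc_symm _ _ _ _ H x u t1 Hx Z1 (s - t1)) as [_ E].
    replace (t1 + (s - t1)) with s in E by ring.
    specialize (N1 (t1 - (s - t1))); lra.
Qed.

Lemma turn_min_period G dG m M (H : tame G dG m M) x u t1 :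
  osc G x u -> 0 < x 0 -> u 0 = 0 -> turn u t1 -> min_period2 x u (2 * t1).
Proof.
  intros Hx P H0 T; pose proof T as [P1 [Z1 _]].
  split; [lra|split; [now apply (osc_periodic _ _ _ _ H x u t1)|]].
  intros s Hs [Ex Eu]; rewrite H0 in Eu.
  pose proof (turn_only_zero _ _ _ _ H x u t1 s Hx T Hs Eu) as ->.
  pose proof (turn_neg _ _ _ _ H x u t1 Hx P H0 T); lra.
Qed.

Lemma min_period_unique x u T1 T2 : min_period2 x u T1 -> min_period2 x u T2 -> T1 = T2.
Proof.
  intros [P1 [A1 M1]] [P2 [A2 M2]].
  destruct (Rtotal_order T1 T2) as [L|[E|L]]; [exfalso|exact E|exfalso].
  - apply (M2 T1); [lra|]. specialize (A1 0); rewrite Rplus_0_l in A1; exact A1.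
  - apply (M1 T2); [lra|]. specialize (A2 0); rewrite Rplus_0_l in A2; exact A2.
Qed.

(** [min_period2] tests returns to the state at time [0] only; by uniqueness a return to the state
    at time [c] after time [s] makes the whole orbit repeat after [s]. *)
Lemma min_period_shift G dG m M (H : tame G dG m M) x u c T :
  osc G x u -> min_period2 x u T -> min_period2 (fun t => x (t + c)) (fun t => u (t + c)) T.
Proof.
  intros Hx [P [A N]]; split; [exact P|split].
  - intros t; replace (t + T + c) with (t + c + T) by ring; apply A.
  - intros s Hs [Ex Eu]; apply (N s Hs).
    rewrite Rplus_0_l in Ex, Eu.
    destruct (osc_unique _ _ _ _ H (fun t => x (t + s)) (fun t => u (t + s)) x u c
                (osc_shift _ _ _ _ Hx) Hx) with (t := 0) as [E1 E2].
    + now rewrite Rplus_comm.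
    + now rewrite Rplus_comm.
    + rewrite Rplus_0_l in E1, E2; now split.
Qed.

(** * Energy levels as single orbits *)

Lemma orbit_amplitude G dG m M (H : tame G dG m M) (x0 u0 : R) :
  ~ (x0 = 0 /\ u0 = 0) -> exists A, 0 < A /\ 2 * V G A = u0 ^ 2 + 2 * V G x0.
Proof.
  intros N; pose proof (tame_pos _ _ _ _ H) as Hm.
  set (E := u0 ^ 2 + 2 * V G x0).
  assert (HE : 0 < E).
  { unfold E; pose proof (V_bounds _ _ _ _ H x0).
    destruct (Req_dec u0 0) as [Zu|Zu].
    - assert (x0 <> 0) by tauto.
      assert (0 < m * x0 ^ 2) by (apply Rmult_lt_0_compat; [lra|]; now apply pow2_gt_0).
      pose proof (pow2_ge_0 u0); lra.
    - pose proof (pow2_gt_0 u0 Zu); pose proof (pow2_ge_0 x0); nra. }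
  (* The point [E / m + 1] lies beyond the level, since [m * (E / m + 1) ^ 2] exceeds [2 * E]. *)
  destruct (ivt (fun s => 2 * V G s) 0 (E / m + 1) E) as [A [HA EA]].
  - intros s _; apply (deriv_continuity _ _ (2 * G s)).
    pose proof (V_deriv _ _ _ _ H s); deriv; ring.
  - rewrite V_0; pose proof (V_bounds _ _ _ _ H (E / m + 1)).
    assert (0 < E / m) by now apply Rdiv_lt_0_compat.
    assert (Q : m * (E / m + 1) ^ 2 = E * (E / m) + 2 * E + m) by (field; lra).
    assert (0 < E * (E / m)) by now apply Rmult_lt_0_compat.
    nra.
  - exists A; split; [|exact EA].
    assert (0 < E / m) by now apply Rdiv_lt_0_compat.
    rewrite between_le in HA by lra.
    destruct (Req_dec A 0) as [Z|Z]; [|lra].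
    rewrite Z, V_0 in EA; lra.
Qed.

(** Within half a period the position sweeps the whole interval allowed by the energy, so it meets
    [x0]. Energy then fixes the velocity up to sign, and reflection about time [0] supplies the
    other sign. *)
Lemma orbit_through G dG m M (H : tame G dG m M) x u (x0 u0 : R) :
  osc G x u -> 0 < x 0 -> u 0 = 0 -> 2 * V G (x 0) = u0 ^ 2 + 2 * V G x0 ->
  exists c, x c = x0 /\ u c = u0.
Proof.
  intros Hx P H0 E.
  destruct (turn_exists _ _ _ _ H x u Hx P H0) as [t1 [T _]].
  pose proof (turn_neg _ _ _ _ H x u t1 Hx P H0 T) as Neg.
  pose proof (osc_energy _ _ _ _ H x u 0 t1 Hx) as E1.
  destruct T as [P1 [Z1 N1]]; rewrite Z1, H0 in E1.
  assert (U : x0 <= x 0).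
  { destruct (Rle_dec x0 (x 0)) as [L|L]; [exact L|].
    pose proof (V_increasing _ _ _ _ H (x 0) x0); pose proof (pow2_ge_0 u0); lra. }
  assert (L : x t1 <= x0).
  { destruct (Rle_dec (x t1) x0) as [L|L]; [exact L|].
    pose proof (V_decreasing _ _ _ _ H x0 (x t1)); pose proof (pow2_ge_0 u0); lra. }
  destruct (ivt x 0 t1 x0) as [c [Hc Ec]].
  - intros s _; eapply deriv_continuity, Hx.
  - nra.
  - pose proof (osc_energy _ _ _ _ H x u 0 c Hx) as E2; rewrite Ec, H0 in E2.
    assert (F : (u c - u0) * (u c + u0) = 0) by lra.
    apply Rmult_integral in F as [F|F].
    + exists c; split; lra.
    + exists (- c); destruct (osc_symm _ _ _ _ H x u 0 Hx H0 (- c)) as [E3 E4].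
      replace (0 + - c) with (- c) in * by ring; replace (0 - - c) with c in * by ring.
      split; lra.
Qed.

Lemma pow2_le_abs (a b : R) : 0 <= b -> a ^ 2 <= b ^ 2 -> Rabs a <= b.
Proof.
  intros Hb L; rewrite <- (Rabs_pos_eq b Hb); apply Rsqr_le_abs_0; unfold Rsqr; nra.
Qed.

(** * Dependence on initial data *)

Lemma osc_lipschitz G dG m M (H : tame G dG m M) x u (a b T : R) :
  osc G x u -> 0 <= T ->
  exists K, 0 < K /\ forall e xe ue, osc G xe ue -> xe 0 = x 0 + e * a -> ue 0 = u 0 + e * b ->
    forall t, 0 <= t <= T -> Rabs (xe t - x t) <= K * Rabs e.
Proof.
  intros Hx HT; pose proof (tame_M_pos _ _ _ _ H) as HM.
  set (E := exp ((2 + M) * T)); assert (HE : 0 < E) by apply exp_pos.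
  (* The added [1] spares a square root: [K ^ 2] is at least [(a ^ 2 + b ^ 2) * E]. *)
  set (K := (a ^ 2 + b ^ 2) * E + 1).
  pose proof (pow2_ge_0 a); pose proof (pow2_ge_0 b).
  assert (HK : 0 <= (a ^ 2 + b ^ 2) * E) by (apply Rmult_le_pos; lra).
  exists K; split; [unfold K; lra|].
  intros e xe ue He Ex Eu t Ht.
  apply pow2_le_abs; [apply Rmult_le_pos; [unfold K; lra | apply Rabs_pos]|].
  pose proof (osc_close _ _ _ _ H xe ue x u 0 t He Hx) as B.
  rewrite Ex, Eu, Rminus_0_r, (Rabs_right t) in B by lra.
  assert (B1 : exp ((2 + M) * t) <= E).
  { apply exp_monotone, Rmult_le_compat_l; lra. }
  pose proof (pow2_ge_0 (ue t - u t)); pose proof (pow2_ge_0 e).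
  replace ((x 0 + e * a - x 0) ^ 2 + (u 0 + e * b - u 0) ^ 2) with (e ^ 2 * (a ^ 2 + b ^ 2)) in B by ring.
  assert (B2 : e ^ 2 * (a ^ 2 + b ^ 2) * exp ((2 + M) * t) <= e ^ 2 * (a ^ 2 + b ^ 2) * E).
  { apply Rmult_le_compat_l; [apply Rmult_le_pos; lra | exact B1]. }
  rewrite Rpow_mult_distr, pow2_abs.
  apply Rle_trans with (e ^ 2 * K); [unfold K; nra|].
  rewrite Rmult_comm; apply Rmult_le_compat_r; [lra|]. unfold K; nra.
Qed.

(* The variational equation is the linearization of the flow. *)
Lemma finite_difference G dG m M (H : tame G dG m M) x u y v (T eta : R) :
  osc G x u -> lin (fun t => dG (x t)) y v -> 0 <= T -> 0 < eta ->
  exists d, 0 < d /\ forall e xe ue, Rabs e < d -> osc G xe ue ->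
    xe 0 = x 0 + e * y 0 -> ue 0 = u 0 + e * v 0 ->
    forall t, 0 <= t <= T ->
      Rabs (xe t - x t - e * y t) <= eta * Rabs e /\
      Rabs (ue t - u t - e * v t) <= eta * Rabs e.
Proof.
  intros Hx Hy HT Heta; pose proof (tame_M_pos _ _ _ _ H) as HM.
  destruct (osc_lipschitz _ _ _ _ H x u (y 0) (v 0) T Hx HT) as [K [HK L]].
  set (E := exp ((2 + M) * T)).
  assert (HE : 1 <= E).
  { unfold E; rewrite <- exp_0; apply exp_monotone, Rmult_le_pos; lra. }
  (* The target [eta / (K * E)] undoes two losses: [K] from the distance between the orbits and [E]
     from the Gronwall growth up to time [T]. *)
  destruct (tame_uniform _ _ _ _ H (eta / (K * E))) as [d [Hd Uc]].
  { apply Rdiv_lt_0_compat; [lra|]; apply Rmult_lt_0_compat; lra. }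
  exists (d / K); split; [now apply Rdiv_lt_0_compat|].
  intros e xe ue He Hxe Ex Eu t Ht.
  apply Rlt_div_r in He; [|exact HK].
  set (D := eta / E * Rabs e).
  assert (HD : 0 <= D).
  { apply Rmult_le_pos; [|apply Rabs_pos]; apply Rdiv_le_0_compat; lra. }
  assert (B : (xe t - x t - e * y t) ^ 2 + (ue t - u t - e * v t) ^ 2
      <= ((xe 0 - x 0 - e * y 0) ^ 2 + (ue 0 - u 0 - e * v 0) ^ 2 + D ^ 2)
         * exp ((2 + M) * Rabs (t - 0))).
  { apply (second_order_bound (fun s => xe s - x s - e * y s) (fun s => ue s - u s - e * v s)
             (fun s => - G (xe s) + G (x s) + e * (dG (x s) * y s))); [lra|].
    intros s Hs; rewrite between_le in Hs by lra.
    destruct (Hxe s), (Hx s), (Hy s).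
    split; [deriv; ring|split; [deriv; ring|]].
    destruct (tame_mean _ _ _ _ H (x s) (xe s)) as [c [Hc Ec]].
    specialize (L e xe ue Hxe Ex Eu s ltac:(lra)).
    (* The error satisfies the linearized equation up to the discrepancy between the mean slope
       [dG c] and [dG (x s)], the source bounded by [D]. *)
    replace (- G (xe s) + G (x s) + e * (dG (x s) * y s))
      with (- (dG (x s) * (xe s - x s - e * y s)) + - ((dG c - dG (x s)) * (xe s - x s))) by lra.
    eapply Rle_trans; [apply Rabs_triang|]; apply Rplus_le_compat.
    - rewrite Rabs_Ropp, Rabs_mult; apply Rmult_le_compat_r; [apply Rabs_pos|].
      apply (tame_abs _ _ _ _ H).
    - rewrite Rabs_Ropp, Rabs_mult.
      assert (Q : Rabs (dG c - dG (x s)) < eta / (K * E)).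
      { apply Uc; apply Rle_lt_trans with (Rabs (xe s - x s)); [|lra].
        destruct (Rle_dec (x s) (xe s)).
        - rewrite between_le in Hc by lra; rewrite !Rabs_right; lra.
        - rewrite between_ge in Hc by lra; rewrite !Rabs_left1; lra. }
      apply Rle_trans with (eta / (K * E) * (K * Rabs e)).
      + apply Rmult_le_compat; try apply Rabs_pos; lra.
      + right; unfold D; field; lra. }
  rewrite Ex, Eu, Rminus_0_r, (Rabs_right t) in B by lra.
  replace ((x 0 + e * y 0 - x 0 - e * y 0) ^ 2 + (u 0 + e * v 0 - u 0 - e * v 0) ^ 2 + D ^ 2)
    with (D ^ 2) in B by ring.
  assert (B1 : exp ((2 + M) * t) <= E).
  { apply exp_monotone, Rmult_le_compat_l; lra. }
  assert (B2 : D ^ 2 * exp ((2 + M) * t) <= (eta * Rabs e) ^ 2).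
  { apply Rle_trans with (D ^ 2 * (E * E)).
    - apply Rmult_le_compat_l; [apply pow2_ge_0|]. nra.
    - right; unfold D; field; lra. }
  assert (0 <= eta * Rabs e) by (apply Rmult_le_pos; [lra | apply Rabs_pos]).
  pose proof (pow2_ge_0 (xe t - x t - e * y t)); pose proof (pow2_ge_0 (ue t - u t - e * v t)).
  split; apply pow2_le_abs; lra.
Qed.

(* If the variational solution is at rest at the turning time [t1 A], then at that time the
   perturbed velocity is [o(h)], so the perturbed turning time moves by [o(h)] only. *)
Lemma turn_time_deriv G dG m M (H : tame G dG m M) (X U : R -> R -> R) (t1 : R -> R) (A : R) y v :
  (forall A, 0 < A -> osc G (X A) (U A) /\ X A 0 = A /\ U A 0 = 0 /\ turn (U A) (t1 A)) ->
  0 < A -> lin (fun t => dG (X A t)) y v -> y 0 = 1 -> v 0 = 0 -> v (t1 A) = 0 ->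
  is_derive t1 A 0.
Proof.
  intros HX PA Hy Y0 V0 V1.
  destruct (HX A PA) as [Hx [x0 [u0 T]]].
  assert (Neg : X A (t1 A) < 0) by (apply (turn_neg _ _ _ _ H (X A) (U A)); auto; lra).
  destruct (turn_exists _ _ _ _ H (X A) (U A)) as [t1' [T' Ub]]; auto; [lra|].
  rewrite (turn_unique _ _ _ T' T) in Ub; clear t1' T'.
  pose proof (tame_pos _ _ _ _ H) as Hm; pose proof (tame_M_pos _ _ _ _ H) as HM.
  set (tau := t1 A) in *; pose proof T as [Ptau [Utau _]].
  (* As [tau <= PI / sqrt m] and perturbed turning times are at least [PI / sqrt M], a zero of the
     perturbed velocity less than [gap] after [tau] lies below twice its turning time. It is then
     that turning time, by [turn_only_zero]. *)
  set (gap := 2 * (PI / sqrt M) - PI / sqrt m).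
  assert (Hgap : 0 < gap).
  { unfold gap; apply Rlt_0_minus.
    assert (Sm : 0 < sqrt m) by now apply sqrt_lt_R0.
    assert (SM : 0 < sqrt M) by now apply sqrt_lt_R0.
    assert (R4 : sqrt M < 2 * sqrt m).
    { replace 2 with (sqrt (2 * 2)) by (apply sqrt_square; lra).
      rewrite <- sqrt_mult by lra; apply sqrt_lt_1; pose proof (tame_ratio _ _ _ _ H); lra. }
    apply Rlt_div_l; [exact Sm|].
    replace (2 * (PI / sqrt M) * sqrt m) with (PI * (2 * sqrt m) / sqrt M) by (field; lra).
    apply (Rlt_div_r PI (PI * (2 * sqrt m)) (sqrt M) SM), Rmult_lt_compat_l;
      [apply PI_RGT_0 | exact R4]. }
  assert (C : continuity_pt (X A) tau) by (eapply deriv_continuity, Hx).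
  destruct (C (- X A tau / 2)) as [d1 [Hd1 N1]]; [lra|].
  assert (N1' : forall t, Rabs (t - tau) < d1 -> X A t < X A tau / 2).
  { intros t Ht; destruct (Req_dec t tau) as [->|Z]; [lra|].
    assert (Q : Rabs (X A t - X A tau) < - X A tau / 2).
    { apply N1; split; [split; [exact I|auto]|]; exact Ht. }
    apply Rabs_lt_between in Q; lra. }
  (* Near [tau] the unperturbed position is below half of [X A tau], and a perturbation smaller than
     [- X A tau / 4] leaves it below a quarter; [c] is the resulting lower bound for the
     acceleration. *)
  set (c := m * (- X A tau / 4)).
  assert (Hc : 0 < c) by (apply Rmult_lt_0_compat; lra).
  apply is_derive_Reals; intros eps Heps.
  destruct (osc_lipschitz _ _ _ _ H (X A) (U A) 1 0 (tau + d1) Hx) as [K [HK L]]; [lra|].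
  destruct (finite_difference _ _ _ _ H (X A) (U A) y v tau (eps * c / 2) Hx Hy) as [d2 [Hd2 FD]].
  { lra. }
  { apply Rdiv_lt_0_compat; [apply Rmult_lt_0_compat|]; lra. }
  set (d3 := Rmin (d1 / 2) (Rmin (gap / 2) (tau / 2))).
  assert (Hd3 : 0 < d3 /\ d3 < d1 /\ d3 < gap /\ d3 < tau).
  { pose proof (Rmin_l (d1 / 2) (Rmin (gap / 2) (tau / 2))).
    pose proof (Rmin_r (d1 / 2) (Rmin (gap / 2) (tau / 2))).
    pose proof (Rmin_l (gap / 2) (tau / 2)); pose proof (Rmin_r (gap / 2) (tau / 2)).
    unfold d3; split; [repeat apply Rmin_glb_lt; lra | lra]. }
  set (d := Rmin A (Rmin d2 (Rmin (- X A tau / 4 / K) (2 * d3 / eps)))).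
  assert (Hd : 0 < d).
  { unfold d; repeat apply Rmin_glb_lt; try lra; repeat apply Rdiv_lt_0_compat; lra. }
  exists (mkposreal d Hd); simpl; intros h Zh Lh.
  assert (Lh' : Rabs h < A /\ Rabs h < d2 /\ Rabs h < - X A tau / 4 / K /\ Rabs h < 2 * d3 / eps).
  { pose proof (Rmin_l A (Rmin d2 (Rmin (- X A tau / 4 / K) (2 * d3 / eps)))).
    pose proof (Rmin_r A (Rmin d2 (Rmin (- X A tau / 4 / K) (2 * d3 / eps)))).
    pose proof (Rmin_l d2 (Rmin (- X A tau / 4 / K) (2 * d3 / eps))).
    pose proof (Rmin_r d2 (Rmin (- X A tau / 4 / K) (2 * d3 / eps))).
    pose proof (Rmin_l (- X A tau / 4 / K) (2 * d3 / eps)).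
    pose proof (Rmin_r (- X A tau / 4 / K) (2 * d3 / eps)).
    unfold d in Lh; lra. }
  clearbody d d3; destruct Lh' as [L1 [L2 [L3 L4]]].
  apply Rlt_div_r in L3; [|lra]. apply Rlt_div_r in L4; [|lra].
  assert (PAh : 0 < A + h) by (apply Rabs_lt_between in L1; lra).
  destruct (HX (A + h) PAh) as [Hxh [xh0 [uh0 Th]]].
  (* Half of the allowed error. By the tolerance [eps * c / 2], the perturbed velocity at [tau] is
     at most [c * xi] in absolute value, and an acceleration of at least [c] brings it to zero
     within time [xi]. *)
  set (xi := eps * Rabs h / 2).
  assert (Hxi : 0 < xi < d3).
  { pose proof (Rabs_pos_lt h Zh); unfold xi; split; [|lra].
    apply Rdiv_lt_0_compat; [apply Rmult_lt_0_compat|]; lra. }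
  assert (Close : forall t, Rabs (t - tau) <= xi -> X (A + h) t < X A tau / 4).
  { intros t Ht; specialize (N1' t ltac:(lra)).
    apply Rabs_le_between in Ht.
    specialize (L h (X (A + h)) (U (A + h)) Hxh ltac:(lra) ltac:(lra) t ltac:(lra)).
    apply Rabs_le_between in L; lra. }
  assert (Steep : forall t, Rabs (t - tau) <= xi -> c <= - G (X (A + h) t)).
  { intros t Ht; specialize (Close t Ht).
    destruct (tame_slope _ _ _ _ H (X (A + h) t)) as [k [Hk ->]].
    replace (- (k * X (A + h) t)) with (k * - X (A + h) t) by ring.
    unfold c; apply Rmult_le_compat; lra. }
  specialize (FD h (X (A + h)) (U (A + h)) L2 Hxh ltac:(rewrite Y0; lra) ltac:(rewrite V0; lra) tau ltac:(lra)).
  destruct FD as [_ FD]; rewrite Utau, V1 in FD.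
  replace (U (A + h) tau - 0 - h * 0) with (U (A + h) tau) in FD by ring.
  replace (eps * c / 2 * Rabs h) with (c * xi) in FD by (unfold xi; field).
  apply Rabs_le_between in FD.
  assert (Hr : 0 <= U (A + h) (tau + xi)).
  { destruct (mvt (U (A + h)) (fun s => - G (X (A + h) s)) tau (tau + xi)) as [s [Hs Es]].
    - intros; apply Hxh.
    - rewrite between_le in Hs by lra.
      specialize (Steep s ltac:(apply Rabs_le; lra)). nra. }
  assert (Hl : U (A + h) (tau - xi) <= 0).
  { destruct (mvt (U (A + h)) (fun s => - G (X (A + h) s)) (tau - xi) tau) as [s [Hs Es]].
    - intros; apply Hxh.
    - rewrite between_le in Hs by lra.
      specialize (Steep s ltac:(apply Rabs_le; lra)). nra. }
  destruct (ivt (U (A + h)) (tau - xi) (tau + xi) 0) as [t [Ht Et]].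
  { intros s _; eapply deriv_continuity, Hxh. }
  { nra. }
  rewrite between_le in Ht by lra.
  assert (Lb : PI / sqrt M <= t1 (A + h)).
  { apply (sturm_lower _ _ _ _ H (X (A + h)) (U (A + h))); auto; lra. }
  assert (E : t = t1 (A + h)).
  { apply (turn_only_zero _ _ _ _ H (X (A + h)) (U (A + h))); auto.
    unfold gap in *; lra. }
  rewrite E in Ht; fold tau.
  rewrite Rminus_0_r; unfold Rdiv; rewrite Rabs_mult, Rabs_inv.
  apply Rlt_div_l; [now apply Rabs_pos_lt|].
  apply Rle_lt_trans with xi; [apply Rabs_le; lra|].
  pose proof (Rabs_pos_lt h Zh); unfold xi; nra.
Qed.

(* Over one period [2 t1] the variational solution gains a fixed nonzero multiple of [x']. *)
Lemma variational_unbounded G dG m M (H : tame G dG m M) x u y v t1 :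
  osc G x u -> 0 < x 0 -> u 0 = 0 -> turn u t1 ->
  lin (fun t => dG (x t)) y v -> y 0 = 1 -> v 0 = 0 -> v t1 <> 0 ->
  forall K, exists t, 0 <= t /\ K < Rabs (v t).
Proof.
  intros Hx P H0 T Hy Y0 V0 N K.
  pose proof (turn_neg _ _ _ _ H x u t1 Hx P H0 T) as Neg.
  destruct T as [P1 [Z1 _]].
  assert (Hq : forall t, Rabs (dG (x t)) <= M) by (intros; apply (tame_abs _ _ _ _ H)).
  assert (Ev : forall t, x (0 - t) = x t /\ u (0 - t) = - u t).
  { intros t; destruct (osc_symm _ _ _ _ H x u 0 Hx H0 (- t)) as [E1 E2].
    replace (0 + - t) with (0 - t) in * by ring; replace (0 - - t) with t in * by ring; auto. }
  pose proof (osc_periodic _ _ _ _ H x u t1 Hx H0 Z1) as Per.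
  (* The coefficient [dG (x t)] is even in time and [y] starts at rest, so [y] is even. *)
  assert (Yev : forall t, y (0 - t) = y t /\ - v (0 - t) = v t).
  { apply (lin_unique (fun t => dG (x t)) (fun t => y (0 - t)) (fun t => - v (0 - t)) y v M 0 Hq).
    - apply (lin_reflect (fun t => dG (x t))); [|exact Hy]. intros t; now rewrite (proj1 (Ev t)).
    - exact Hy.
    - now rewrite Rminus_0_r.
    - rewrite Rminus_0_r, V0; ring. }
  set (p := - G (x t1)).
  assert (Hp : 0 < p).
  { unfold p; destruct (tame_slope _ _ _ _ H (x t1)) as [k [Hk ->]].
    pose proof (tame_pos _ _ _ _ H); nra. }
  set (k := 2 * v t1 / p).
  (* Two solutions of one linear equation, compared at [- t1]. There evenness of [y] leaves a gain
     of zero in position and [2 * v t1] in velocity, while [u] vanishes with derivative [p]; hence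
     the value of [k]. *)
  assert (Gain : forall t, y (t + 2 * t1) - y t = k * u t /\ v (t + 2 * t1) - v t = k * - G (x t)).
  { intros t.
    pose proof (lin_shift (fun t => dG (x t)) y v (2 * t1)
      (fun t => f_equal dG (proj1 (Per t))) Hy) as Sh.
    pose proof (lin_comb _ _ _ _ _ 1 (-1) Sh Hy) as L1.
    pose proof (lin_comb _ _ _ _ _ k 0 (osc_lin _ _ _ _ H x u Hx) Hy) as L2.
    destruct (Yev t1) as [Y1 Y2], (Ev t1) as [X1 X2].
    destruct (lin_unique _ _ _ _ _ M (- t1) Hq L1 L2) with (t := t) as [E1 E2].
    - replace (- t1 + 2 * t1) with t1 by ring; replace (- t1) with (0 - t1) by ring.
      rewrite Y1, X2, Z1; ring.
    - replace (- t1 + 2 * t1) with t1 by ring; replace (- t1) with (0 - t1) by ring.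
      rewrite X1; fold p; replace (v (0 - t1)) with (- v t1) by lra. unfold k; field; lra.
    - split; lra. }
  assert (HG : 0 < G (x 0)).
  { destruct (tame_slope _ _ _ _ H (x 0)) as [j [Hj ->]].
    pose proof (tame_pos _ _ _ _ H); apply Rmult_lt_0_compat; lra. }
  (* At multiples of the period [u] vanishes, so the growth shows in [v] and not in [y]. *)
  assert (Iter : forall n, v (INR n * (2 * t1)) = INR n * (k * - G (x 0)) /\ x (INR n * (2 * t1)) = x 0).
  { induction n as [|n [IH1 IH2]].
    - simpl; rewrite !Rmult_0_l; auto.
    - rewrite S_INR.
      replace ((INR n + 1) * (2 * t1)) with (INR n * (2 * t1) + 2 * t1) by ring.
      destruct (Per (INR n * (2 * t1))) as [E _], (Gain (INR n * (2 * t1))) as [_ E2].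
      rewrite IH2 in E, E2; split; [lra | exact E]. }
  assert (Hk : 0 < Rabs (k * - G (x 0))).
  { apply Rabs_pos_lt, Rmult_integral_contrapositive; split; [|lra].
    unfold k; intros E; apply N.
    apply (Rmult_eq_reg_r (2 / p)); [|apply Rgt_not_eq, Rdiv_lt_0_compat; lra].
    transitivity (2 * v t1 / p); [field; lra|]. rewrite E; ring. }
  destruct (INR_unbounded (K / Rabs (k * - G (x 0)))) as [n Hn].
  exists (INR n * (2 * t1)); split; [apply Rmult_le_pos; [apply pos_INR | lra]|].
  rewrite (proj1 (Iter n)), Rabs_mult, (Rabs_right (INR n)) by (apply Rle_ge, pos_INR).
  apply Rlt_div_l in Hn; lra.
Qed.

(** * Isochronous oscillators *)

(** Stated through half periods of orbits released on the positive side; every other nontrivial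
    orbit of small energy is a time shift of one of them. *)
Definition isochronous_below (G : R -> R) (T k : R) : Prop :=
  forall A x u, 0 < A < k -> osc G x u -> x 0 = A -> u 0 = 0 -> turn u (T / 2).

Lemma rest_at_turn_isochronous G dG m M (H : tame G dG m M) (k : R) :
  0 < k ->
  (forall x u y v t1, osc G x u -> 0 < x 0 < k -> u 0 = 0 -> turn u t1 ->
     lin (fun t => dG (x t)) y v -> y 0 = 1 -> v 0 = 0 -> v t1 = 0) ->
  exists T, 0 < T /\ isochronous_below G T k.
Proof.
  intros Pk Rest.
  (* One orbit is chosen per amplitude, so that the turning time becomes a function that can be
     differentiated; the entry for [A <= 0] is a dummy. *)
  assert (Fam : forall A, exists p : (R -> R) * (R -> R) * R, 0 < A ->
     osc G (fst (fst p)) (snd (fst p)) /\ fst (fst p) 0 = A /\ snd (fst p) 0 = 0 /\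
     turn (snd (fst p)) (snd p)).
  { intros A; destruct (osc_exists _ _ _ _ H A 0) as [x [u [Hx [X0 U0]]]].
    destruct (Rlt_dec 0 A) as [P|P]; [|exists (x, u, 0); intros; lra].
    destruct (turn_exists _ _ _ _ H x u Hx) as [t1 [T _]]; [lra|exact U0|].
    exists (x, u, t1); intros _; simpl; auto. }
  apply choice in Fam as [f Hf].
  set (t1 := fun A => snd (f A)).
  assert (D : forall A, 0 < A < k -> is_derive t1 A 0).
  { intros A HA; destruct (Hf A ltac:(lra)) as [Hx [X0 [U0 T]]].
    destruct (lin_exists _ _ _ _ H _ _ 1 0 Hx) as [y [v [Hy [Y0 V0]]]].
    apply (turn_time_deriv _ _ _ _ H (fun A => fst (fst (f A))) (fun A => snd (fst (f A))) t1 A y v);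
      auto; [lra|].
    apply (Rest _ _ y v (t1 A) Hx); auto; lra. }
  assert (Const : forall A, 0 < A < k -> t1 A = t1 (k / 2)).
  { intros A HA; apply (constant_between t1 (fun _ => 0)).
    intros s Hs; split; [|reflexivity]; apply D.
    destruct (Rle_dec (k / 2) A).
    - rewrite between_le in Hs by lra; lra.
    - rewrite between_ge in Hs by lra; lra. }
  exists (2 * t1 (k / 2)); split.
  - destruct (Hf (k / 2) ltac:(lra)) as [_ [_ [_ [P _]]]]; unfold t1; lra.
  - intros A x u HA Hx X0 U0.
    replace (2 * t1 (k / 2) / 2) with (t1 (k / 2)) by field; rewrite <- (Const A HA).
    destruct (Hf A ltac:(lra)) as [Hx' [X0' [U0' T]]].
    refine (turn_ext _ _ _ _ T).
    intros t; apply (osc_unique _ _ _ _ H _ _ x u 0 Hx' Hx); congruence.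
Qed.

(** The smallness condition keeps the amplitude below [k]: [u 0 ^ 2 + M * x 0 ^ 2] dominates twice
    the energy of the orbit, and twice the potential at [k] is at least [m * k ^ 2]. *)
Lemma isochronous_min_period G dG m M (H : tame G dG m M) T k x u :
  isochronous_below G T k -> 0 < k -> osc G x u -> ~ (x 0 = 0 /\ u 0 = 0) ->
  u 0 ^ 2 + M * x 0 ^ 2 < m * k ^ 2 -> min_period2 x u T.
Proof.
  intros Iso Pk Hx N S; pose proof (tame_pos _ _ _ _ H) as Hm.
  destruct (orbit_amplitude _ _ _ _ H (x 0) (u 0) N) as [A [PA EA]].
  pose proof (V_bounds _ _ _ _ H A); pose proof (V_bounds _ _ _ _ H (x 0)).
  assert (LA : A < k).
  { destruct (Rlt_dec A k) as [L|L]; [exact L|]. assert (k ^ 2 <= A ^ 2) by nra. nra. }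
  destruct (osc_exists _ _ _ _ H A 0) as [xa [ua [Ha [Xa Ua]]]].
  pose proof (Iso A xa ua ltac:(lra) Ha Xa Ua) as Ta.
  pose proof (turn_min_period _ _ _ _ H xa ua _ Ha ltac:(lra) Ua Ta) as P.
  replace (2 * (T / 2)) with T in P by field.
  destruct (orbit_through _ _ _ _ H xa ua (x 0) (u 0) Ha) as [c [Ec Fc]]; auto; try lra.
  { rewrite Xa; exact EA. }
  pose proof (min_period_shift _ _ _ _ H xa ua c T Ha P) as [P1 [P2 P3]].
  assert (E : forall t, xa (t + c) = x t /\ ua (t + c) = u t).
  { apply (osc_unique _ _ _ _ H (fun t => xa (t + c)) (fun t => ua (t + c)) x u 0);
      auto using osc_shift; now rewrite Rplus_0_l. }
  split; [exact P1|split].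
  - intros t; destruct (E t) as [<- <-], (E (t + T)) as [<- <-]; apply P2.
  - intros s Hs; destruct (E s) as [<- <-], (E 0) as [<- <-]; now apply P3.
Qed.

Lemma isochronous_periodic G dG m M (H : tame G dG m M) T k x u :
  isochronous_below G T k -> 0 < k -> osc G x u ->
  u 0 ^ 2 + M * x 0 ^ 2 < m * k ^ 2 -> forall t, x (t + T) = x t /\ u (t + T) = u t.
Proof.
  intros Iso Pk Hx S.
  destruct (classic (x 0 = 0 /\ u 0 = 0)) as [[Z1 Z2]|N].
  - intros t.
    destruct (osc_unique _ _ _ _ H x u _ _ 0 Hx (osc_zero _ _ _ _ H) Z1 Z2 t) as [-> ->].
    apply (osc_unique _ _ _ _ H x u _ _ 0 Hx (osc_zero _ _ _ _ H) Z1 Z2).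
  - apply (isochronous_min_period _ _ _ _ H T k x u Iso Pk Hx N S).
Qed.

(* In the isochronous case the time-[T] map of the nonlinear flow is the identity near the
   origin, hence so is its derivative. *)
Lemma isochronous_lin_periodic G dG m M (H : tame G dG m M) T k x u y v :
  isochronous_below G T k -> 0 < k -> 0 < T -> osc G x u ->
  u 0 ^ 2 + M * x 0 ^ 2 < m * k ^ 2 -> lin (fun t => dG (x t)) y v ->
  forall t, y (t + T) = y t /\ v (t + T) = v t.
Proof.
  intros Iso Pk PT Hx S Hy.
  pose proof (isochronous_periodic _ _ _ _ H T k x u Iso Pk Hx S) as Per.
  assert (Near : exists d, 0 < d /\ forall e, Rabs e < d ->
     (u 0 + e * v 0) ^ 2 + M * (x 0 + e * y 0) ^ 2 < m * k ^ 2).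
  { set (f := fun e => (u 0 + e * v 0) ^ 2 + M * (x 0 + e * y 0) ^ 2).
    assert (C : continuity_pt f 0).
    { eapply deriv_continuity; unfold f; deriv; reflexivity. }
    destruct (C (m * k ^ 2 - f 0)) as [d [Hd B]]; [unfold f; rewrite !Rmult_0_l, !Rplus_0_r; lra|].
    exists d; split; [exact Hd|]; intros e He.
    change (f e < m * k ^ 2).
    destruct (Req_dec e 0) as [->|Z].
    - unfold f; rewrite !Rmult_0_l, !Rplus_0_r; lra.
    - assert (Q : Rabs (f e - f 0) < m * k ^ 2 - f 0).
      { apply B; split; [split; [exact I|auto]|]. simpl; unfold R_dist; now rewrite Rminus_0_r. }
      apply Rabs_lt_between in Q; lra. }
  destruct Near as [d0 [Hd0 Near]].
  assert (At0 : forall eta, 0 < eta -> Rabs (y 0 - y T) <= eta /\ Rabs (v 0 - v T) <= eta).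
  { intros eta Heta.
    destruct (finite_difference _ _ _ _ H x u y v T eta Hx Hy ltac:(lra) Heta) as [d [Hd FD]].
    set (e := Rmin d d0 / 2).
    assert (He : 0 < e /\ e < d /\ e < d0).
    { pose proof (Rmin_l d d0); pose proof (Rmin_r d d0).
      assert (0 < Rmin d d0) by now apply Rmin_glb_lt. unfold e; lra. }
    assert (Ae : Rabs e = e) by (apply Rabs_right; lra).
    destruct (osc_exists _ _ _ _ H (x 0 + e * y 0) (u 0 + e * v 0)) as [xe [ue [Hxe [Xe Ue]]]].
    destruct (FD e xe ue ltac:(lra) Hxe Xe Ue T ltac:(lra)) as [B1 B2].
    destruct (isochronous_periodic _ _ _ _ H T k xe ue Iso Pk Hxe) with (t := 0) as [P1 P2].
    { rewrite Xe, Ue; apply Near; lra. }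
    destruct (Per 0) as [Q1 Q2].
    rewrite Rplus_0_l in P1, P2, Q1, Q2.
    rewrite P1, Q1, Xe, Ae in B1; rewrite P2, Q2, Ue, Ae in B2.
    replace (x 0 + e * y 0 - x 0 - e * y T) with ((y 0 - y T) * e) in B1 by ring.
    replace (u 0 + e * v 0 - u 0 - e * v T) with ((v 0 - v T) * e) in B2 by ring.
    rewrite Rabs_mult, Ae in B1, B2.
    split; apply (Rmult_le_reg_r e); lra. }
  assert (Z : forall a, (forall eta, 0 < eta -> Rabs a <= eta) -> a = 0).
  { intros a B; destruct (Req_dec a 0) as [E|E]; [exact E|exfalso].
    pose proof (Rabs_pos_lt a E); specialize (B (Rabs a / 2)); lra. }
  assert (Ey : y 0 - y T = 0) by (apply Z; intros; now apply At0).
  assert (Ev : v 0 - v T = 0) by (apply Z; intros; now apply At0).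
  intros t.
  apply (lin_unique (fun t => dG (x t)) (fun t => y (t + T)) (fun t => v (t + T)) y v M 0); auto.
  - intros s; apply (tame_abs _ _ _ _ H).
  - apply (lin_shift (fun t => dG (x t))); [|exact Hy]. intros s; now rewrite (proj1 (Per s)).
  - rewrite Rplus_0_l; lra.
  - rewrite Rplus_0_l; lra.
Qed.

Lemma lin_const_solution w y0 v0 : 0 < w ->
  lin (fun _ => w ^ 2) (fun t => y0 * cos (w * t) + v0 / w * sin (w * t))
    (fun t => v0 * cos (w * t) + - (y0 * w) * sin (w * t)).
Proof.
  intros Hw t; pose proof (sin_deriv w t); pose proof (cos_deriv w t).
  split; deriv; field; lra.
Qed.

(** Periodicity of the linearization at rest only makes [w * T] a multiple of [2 * PI]. The bounds
    [T / 2 <= PI / sqrt m] and [w < 2 * sqrt m] exclude the higher multiples. *)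
Lemma isochronous_frequency G dG m M (H : tame G dG m M) T k :
  isochronous_below G T k -> 0 < k -> 0 < T -> sqrt (dG 0) * T = 2 * PI.
Proof.
  intros Iso Pk PT; set (w := sqrt (dG 0)).
  pose proof (tame_pos _ _ _ _ H) as Hm; pose proof (tame_bounds _ _ _ _ H 0) as B.
  pose proof (tame_ratio _ _ _ _ H) as HR.
  assert (Hw : 0 < w) by (apply sqrt_lt_R0; lra).
  assert (Hw2 : w ^ 2 = dG 0) by (apply pow2_sqrt; lra).
  pose proof (lin_const_solution w 1 0 Hw) as L; rewrite Hw2 in L.
  assert (S0 : 0 ^ 2 + M * 0 ^ 2 < m * k ^ 2).
  { assert (0 < m * k ^ 2) by (apply Rmult_lt_0_compat; [lra | now apply pow_lt]). lra. }
  destruct (isochronous_lin_periodic _ _ _ _ H T k (fun _ => 0) (fun _ => 0) _ _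
              Iso Pk PT (osc_zero _ _ _ _ H) S0 L 0) as [E _].
  rewrite Rplus_0_l, Rmult_0_r, cos_0, sin_0 in E.
  assert (C : cos (w * T) = 1) by lra.
  assert (Lt : w * (T / 2) < 2 * PI).
  { destruct (osc_exists _ _ _ _ H (k / 2) 0) as [x [u [Hx [X0 U0]]]].
    pose proof (Iso (k / 2) x u ltac:(lra) Hx X0 U0) as Tn.
    destruct (turn_exists _ _ _ _ H x u Hx) as [t1 [Tn' Ub]]; [lra|exact U0|].
    rewrite (turn_unique _ _ _ Tn' Tn) in Ub.
    assert (Sm : 0 < sqrt m) by now apply sqrt_lt_R0.
    assert (W2 : w < 2 * sqrt m).
    { replace 2 with (sqrt (2 * 2)) by (apply sqrt_square; lra).
      rewrite <- sqrt_mult by lra; apply sqrt_lt_1; lra. }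
    pose proof PI_RGT_0.
    apply Rle_lt_trans with (w * (PI / sqrt m)); [apply Rmult_le_compat_l; lra|].
    replace (w * (PI / sqrt m)) with (w * PI / sqrt m) by (field; lra).
    apply Rlt_div_l; nra. }
  assert (Pw : 0 < w * (T / 2)) by (apply Rmult_lt_0_compat; lra).
  assert (S : sin (w * (T / 2)) = 0).
  { replace (w * T) with (2 * (w * (T / 2))) in C by field.
    rewrite cos_2a_sin in C; nra. }
  destruct (sin_eq_O_2PI_0 (w * (T / 2))) as [E1|[E1|E1]]; try lra; assumption.
Qed.

Lemma lin_const_no_return w y v T s :
  0 < w -> w * T = 2 * PI -> lin (fun _ => w ^ 2) y v -> ~ (y 0 = 0 /\ v 0 = 0) ->
  0 < s < T -> ~ (y s = y 0 /\ v s = v 0).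
Proof.
  intros Hw HT Hy N Hs [Ey Ev].
  destruct (lin_unique (fun _ => w ^ 2) y v _ _ (Rabs (w ^ 2)) 0 (fun _ => Rle_refl _) Hy
              (lin_const_solution w (y 0) (v 0) Hw)) with (t := s) as [E1 E2].
  { rewrite Rmult_0_r, cos_0, sin_0; ring. }
  { rewrite Rmult_0_r, cos_0, sin_0; ring. }
  rewrite Ey in E1; rewrite Ev in E2.
  set (C := cos (w * s)) in *; set (S := sin (w * s)) in *.
  assert (F1 : w * y 0 * (C - 1) + v 0 * S = 0).
  { replace (w * y 0 * (C - 1) + v 0 * S) with (w * ((y 0 * C + v 0 / w * S) - y 0)) by (field; lra).
    rewrite <- E1; ring. }
  assert (F2 : v 0 * (C - 1) - w * y 0 * S = 0) by lra.
  (* A rotation minus the identity multiplies the squared length of [(w * y 0, v 0)] by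
     [(C - 1) ^ 2 + S ^ 2], so a return forces the rotation to be trivial. *)
  assert (F3 : ((w * y 0) ^ 2 + v 0 ^ 2) * ((C - 1) ^ 2 + S ^ 2) = 0).
  { transitivity ((w * y 0 * (C - 1) + v 0 * S) ^ 2 + (v 0 * (C - 1) - w * y 0 * S) ^ 2); [ring|].
    rewrite F1, F2; ring. }
  assert (Pos : 0 < (w * y 0) ^ 2 + v 0 ^ 2).
  { destruct (Req_dec (v 0) 0) as [Zv|Zv].
    - assert (Zy : y 0 <> 0) by tauto.
      assert (w * y 0 <> 0) by (apply Rmult_integral_contrapositive; split; lra).
      pose proof (pow2_gt_0 (w * y 0)); pose proof (pow2_ge_0 (v 0)); intuition lra.
    - pose proof (pow2_gt_0 (v 0) Zv); pose proof (pow2_ge_0 (w * y 0)); lra. }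
  assert (F4 : (C - 1) ^ 2 + S ^ 2 = 0).
  { apply Rmult_integral in F3 as [F3|F3]; [lra|exact F3]. }
  assert (C1 : C = 1).
  { pose proof (pow2_ge_0 S); pose proof (pow2_ge_0 (C - 1)).
    assert (C - 1 = 0); [|lra]. apply Rsqr_0_uniq; unfold Rsqr; nra. }
  assert (S2 : sin (w * (s / 2)) = 0).
  { unfold C in C1; replace (w * s) with (2 * (w * (s / 2))) in C1 by field.
    rewrite cos_2a_sin in C1; nra. }
  assert (0 < sin (w * (s / 2))); [|lra].
  apply sin_gt_0; nra.
Qed.

(** * Transfer to the local system *)

Definition smooth_force (g dg : R -> R) (r : R) : Prop :=
  0 < r /\ (forall s, -r < s < r -> is_derive g s (dg s)) /\
  (forall s, -r < s < r -> continuous dg s) /\ g 0 = 0 /\ 0 < dg 0.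

Record extension (g dg : R -> R) (r : R) (G dG : R -> R) (m M rho : R) : Prop := {
  ext_force : smooth_force g dg r;
  ext_tame : tame G dG m M;
  ext_radius : 0 < rho < r;
  ext_agree : forall s, - rho <= s <= rho -> G s = g s /\ dG s = dg s }.

(** It is the derivative that gets extended: clamping its argument to [[- rho, rho]] keeps
    continuity and bounds, and integration from [0] gives a [C ^ 1] force. The clamp is 1-Lipschitz,
    so Heine's theorem on the compact interval gives uniform continuity on the line. *)
Lemma extension_exists g dg r : smooth_force g dg r ->
  exists G dG m M rho, extension g dg r G dG m M rho.
Proof.
  intros F; pose proof F as [Hr [Dg [Cg [g0 P0]]]].
  assert (C0 : continuity_pt dg 0) by (apply continuity_pt_filterlim, Cg; lra).
  (* Slopes within [dg 0 / 2] of [dg 0] have ratio at most [3], which respects [M < 4 * m]. *)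
  destruct (C0 (dg 0 / 2)) as [d [Hd N]]; [lra|].
  set (rho := Rmin d r / 2).
  assert (Hrho : 0 < rho /\ rho < d /\ rho < r).
  { pose proof (Rmin_l d r); pose proof (Rmin_r d r).
    assert (0 < Rmin d r) by now apply Rmin_glb_lt. unfold rho; lra. }
  clearbody rho.
  assert (B : forall s, - rho <= s <= rho -> dg 0 / 2 <= dg s <= 3 * (dg 0 / 2)).
  { intros s Hs; destruct (Req_dec s 0) as [->|Z]; [lra|].
    assert (Q : Rabs (dg s - dg 0) < dg 0 / 2).
    { apply N; split; [split; [exact I|auto]|]. simpl; unfold R_dist; rewrite Rminus_0_r.
      apply Rabs_lt_between; lra. }
    apply Rabs_lt_between in Q; lra. }
  set (clamp := fun s => Rmax (- rho) (Rmin s rho)).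
  assert (Hc : forall s, - rho <= clamp s <= rho).
  { intros s; unfold clamp; split; [apply Rmax_l|]. apply Rmax_lub; [lra | apply Rmin_r]. }
  assert (Ec : forall s, - rho <= s <= rho -> clamp s = s).
  { intros s Hs; unfold clamp; rewrite Rmin_left, Rmax_right; lra. }
  assert (Lc : forall a b, Rabs (clamp a - clamp b) <= Rabs (a - b)).
  { intros a b; unfold clamp, Rmax, Rmin; repeat destruct Rle_dec;
      apply Rabs_le; (destruct (Rle_dec a b); [rewrite Rabs_left1 by lra|rewrite Rabs_right by lra]); lra. }
  set (dG := fun s => dg (clamp s)).
  assert (Uc : forall e, 0 < e -> exists d, 0 < d /\
    forall a b, Rabs (a - b) < d -> Rabs (dG a - dG b) < e).
  { intros e He.
    destruct (Heine dg (fun s => - rho <= s <= rho) (compact_P3 _ _)) with (eps := mkposreal e He)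
      as [de Hde].
    - intros s Hs; apply continuity_pt_filterlim, Cg; lra.
    - exists de; split; [apply cond_pos|]; intros a b Hab.
      apply Hde; auto; eapply Rle_lt_trans; [apply Lc | exact Hab]. }
  assert (CG : forall s, continuous dG s).
  { intros s; apply continuity_pt_filterlim; intros e He.
    destruct (Uc e He) as [de [Hde Q]].
    exists de; split; [exact Hde|]; intros s' [_ Hs]; now apply Q. }
  pose proof (continuous_RInt_deriv dG CG 0) as DG.
  assert (G0 : RInt dG 0 0 = 0) by now rewrite RInt_point.
  exists (RInt dG 0), dG, (dg 0 / 2), (3 * (dg 0 / 2)), rho.
  split; [exact F| |lra|].
  - split; [lra|lra|exact G0|exact DG| |exact Uc]. intros s; apply B, Hc.
  - intros s Hs; split; [|unfold dG; now rewrite Ec].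
    assert (E : RInt dG 0 s - g s = RInt dG 0 0 - g 0).
    { apply (constant_between (fun s => RInt dG 0 s - g s) (fun s => dG s - dg s)).
      intros q Hq.
      assert (Hq' : - rho <= q <= rho).
      { destruct (Rle_dec 0 s); [rewrite between_le in Hq by lra|rewrite between_ge in Hq by lra]; lra. }
      specialize (DG q); pose proof (Dg q ltac:(lra)).
      split; [deriv; ring|]. unfold dG; rewrite Ec by exact Hq'; ring. }
    rewrite G0, g0 in E; lra.
Qed.

Lemma V_agree g dg r G dG m M rho (X : extension g dg r G dG m M rho) s :
  - rho <= s <= rho -> V g s = V G s.
Proof.
  intros Hs; apply RInt_ext; intros q Hq.
  symmetry; apply (ext_agree _ _ _ _ _ _ _ _ X).
  pose proof (ext_radius _ _ _ _ _ _ _ _ X).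
  assert (Hq' : between 0 s q) by (unfold between; lra).
  destruct (Rle_dec 0 s); [rewrite between_le in Hq' by lra|rewrite between_ge in Hq' by lra]; lra.
Qed.

(** Needed on all of [(-r, r)], because a local solution is not known beforehand to stay where [g]
    and [G] agree. *)
Lemma V_local_deriv g dg r : smooth_force g dg r ->
  forall s, -r < s < r -> is_derive (V g) s (g s).
Proof.
  intros [Hr [Dg _]] s Hs.
  apply (is_derive_RInt g (V g) 0 s); [|eapply deriv_continuous, Dg, Hs].
  assert (P : 0 < Rmin (r - s) (s + r)) by (apply Rmin_glb_lt; lra).
  exists (mkposreal _ P); intros q Hq.
  change (Rabs (q - s) < Rmin (r - s) (s + r)) in Hq.
  pose proof (Rmin_l (r - s) (s + r)); pose proof (Rmin_r (r - s) (s + r)).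
  apply Rabs_lt_between in Hq.
  apply (@RInt_correct R_CompleteNormedModule), (@ex_RInt_continuous R_CompleteNormedModule).
  intros z Hz; change (between 0 q z) in Hz; eapply deriv_continuous, Dg.
  destruct (Rle_dec 0 q); [rewrite between_le in Hz by lra|rewrite between_ge in Hz by lra]; lra.
Qed.

(** An energy barrier: at [rho] and [- rho] twice the potential is at least [m * rho ^ 2], more than
    the orbit has at its disposal, so by continuity it reaches neither. Any local solution on any
    time interval is covered. *)
Lemma trapped g dg r G dG m M rho (X : extension g dg r G dG m M rho) x u t0 t :
  (forall s, between t0 t s ->
     -r < x s < r /\ is_derive x s (u s) /\ is_derive u s (- g (x s))) ->
  u t0 ^ 2 + M * x t0 ^ 2 < m * rho ^ 2 ->
  - rho < x t < rho /\ u t ^ 2 + m * x t ^ 2 <= u t0 ^ 2 + M * x t0 ^ 2.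
Proof.
  intros Hx S.
  pose proof (ext_tame _ _ _ _ _ _ _ _ X) as H; pose proof (ext_radius _ _ _ _ _ _ _ _ X) as Hr.
  pose proof (tame_pos _ _ _ _ H) as Hm; pose proof (tame_ratio _ _ _ _ H) as HM.
  assert (En : forall s, between t0 t s -> u s ^ 2 + 2 * V g (x s) = u t0 ^ 2 + 2 * V g (x t0)).
  { intros s Hs; apply (constant_between (fun s => u s ^ 2 + 2 * V g (x s)) (fun _ => 0)).
    intros q Hq; split; [|reflexivity].
    destruct (Hx q (between_trans _ _ _ _ Hs Hq)) as [B [H1 H2]].
    pose proof (deriv_comp _ _ _ _ _
      (V_local_deriv g dg r (ext_force _ _ _ _ _ _ _ _ X) (x q) B) H1); deriv; ring. }
  assert (W : forall a, - rho < a < rho \/ m * rho ^ 2 <= m * a ^ 2).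
  { intros a; destruct (Rlt_dec (- rho) a), (Rlt_dec a rho);
      [left; lra | right | right | right]; (apply Rmult_le_compat_l; [lra | nra]). }
  assert (X0 : - rho < x t0 < rho).
  { destruct (W (x t0)) as [L|L]; [exact L|].
    pose proof (pow2_ge_0 (u t0)); pose proof (pow2_ge_0 (x t0)); nra. }
  rewrite (V_agree _ _ _ _ _ _ _ _ X (x t0)) in En by lra.
  pose proof (V_bounds _ _ _ _ H (x t0)) as V0.
  assert (Bar : forall a s, a ^ 2 = rho ^ 2 -> - rho <= a <= rho -> between t0 t s -> x s <> a).
  { intros a s Ea Ha Hs Es; specialize (En s Hs); rewrite Es in En.
    rewrite (V_agree _ _ _ _ _ _ _ _ X a) in En by lra.
    pose proof (V_bounds _ _ _ _ H a) as Va; rewrite Ea in Va.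
    pose proof (pow2_ge_0 (u s)); lra. }
  assert (Cx : forall s, between t0 t s -> continuity_pt x s).
  { intros s Hs; destruct (Hx s Hs) as [_ [H1 _]]; eapply deriv_continuity, H1. }
  assert (Xt : - rho < x t < rho).
  { split.
    - destruct (Rlt_dec (- rho) (x t)) as [L|L]; [exact L|exfalso].
      destruct (ivt x t0 t (- rho) Cx) as [s [Hs Es]]; [nra|].
      apply (Bar (- rho) s); auto; [ring|lra].
    - destruct (Rlt_dec (x t) rho) as [L|L]; [exact L|exfalso].
      destruct (ivt x t0 t rho Cx) as [s [Hs Es]]; [nra|].
      apply (Bar rho s); auto; lra. }
  split; [exact Xt|].
  specialize (En t (between_r _ _)).
  rewrite (V_agree _ _ _ _ _ _ _ _ X (x t)) in En by lra.
  pose proof (V_bounds _ _ _ _ H (x t)); lra.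
Qed.

Lemma osc_confined G dG m M (H : tame G dG m M) x u k :
  osc G x u -> 0 < k -> u 0 ^ 2 + M * x 0 ^ 2 < m * k ^ 2 -> forall t, - k < x t < k.
Proof.
  intros Hx Pk S t; pose proof (tame_pos _ _ _ _ H).
  pose proof (osc_energy _ _ _ _ H x u 0 t Hx).
  pose proof (V_bounds _ _ _ _ H (x 0)); pose proof (V_bounds _ _ _ _ H (x t)).
  pose proof (pow2_ge_0 (u t)).
  assert (x t ^ 2 < k ^ 2) by nra.
  split; nra.
Qed.

Lemma osc_sys_sol g dg r G dG m M rho (X : extension g dg r G dG m M rho) x y u v :
  osc G x u -> lin (fun t => dG (x t)) y v -> u 0 ^ 2 + M * x 0 ^ 2 < m * rho ^ 2 ->
  forall I, sys_sol g dg r I x y u v.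
Proof.
  intros Hx Hy S I t _.
  pose proof (ext_radius _ _ _ _ _ _ _ _ X) as Hr.
  pose proof (osc_confined _ _ _ _ (ext_tame _ _ _ _ _ _ _ _ X) x u rho Hx (proj1 Hr) S t).
  destruct (ext_agree _ _ _ _ _ _ _ _ X (x t) ltac:(lra)) as [<- <-].
  split; [lra|]. destruct (Hx t), (Hy t); auto.
Qed.

Lemma sys_exists g dg r G dG m M rho (X : extension g dg r G dG m M rho) x0 y0 u0 v0 :
  u0 ^ 2 + M * x0 ^ 2 < m * rho ^ 2 ->
  exists x y u v, osc G x u /\ lin (fun t => dG (x t)) y v /\
    sys_init x y u v x0 y0 u0 v0 /\ forall I, sys_sol g dg r I x y u v.
Proof.
  intros S; pose proof (ext_tame _ _ _ _ _ _ _ _ X) as H.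
  destruct (osc_exists _ _ _ _ H x0 u0) as [x [u [Hx [X0 U0]]]].
  destruct (lin_exists _ _ _ _ H x u y0 v0 Hx) as [y [v [Hy [Y0 V0]]]].
  exists x, y, u, v; split; [exact Hx|split; [exact Hy|split; [now repeat split|]]].
  apply (osc_sys_sol _ _ _ _ _ _ _ _ X); auto; now rewrite X0, U0.
Qed.

Lemma sol2_unique g dg r G dG m M rho (X : extension g dg r G dG m M rho) x u xg ug t :
  osc G x u -> u 0 ^ 2 + M * x 0 ^ 2 < m * rho ^ 2 ->
  sol2 g r (between 0 t) xg ug -> xg 0 = x 0 -> ug 0 = u 0 ->
  xg t = x t /\ ug t = u t /\ - rho < xg t < rho.
Proof.
  intros Hx S Hg X0 U0; pose proof (ext_tame _ _ _ _ _ _ _ _ X) as H.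
  assert (Tr : forall s, between 0 t s -> - rho < xg s < rho).
  { intros s Hs; apply (trapped _ _ _ _ _ _ _ _ X xg ug 0 s).
    - intros q Hq; apply Hg; eapply between_trans; eassumption.
    - now rewrite X0, U0. }
  assert (E : xg t = x t /\ ug t = u t).
  { apply (second_order_unique xg ug (fun s => - g (xg s)) x u (fun s => - G (x s)) M 0); auto.
    - left; apply (tame_M_pos _ _ _ _ H).
    - intros s Hs; split; [apply Hg, Hs|split; [apply Hx|]].
      specialize (Tr s Hs).
      destruct (ext_agree _ _ _ _ _ _ _ _ X (xg s)) as [<- _]; [lra|].
      apply (tame_lip _ _ _ _ H). }
  destruct E; split; [assumption|split; [assumption|apply Tr, between_r]].
Qed.

(** The system is triangular: once the planar parts coincide, both [y] components solve the same
    linear equation. *)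
Lemma sys_unique g dg r G dG m M rho (X : extension g dg r G dG m M rho)
    x y u v xg yg ug vg (I : R -> Prop) t :
  osc G x u -> lin (fun t => dG (x t)) y v -> u 0 ^ 2 + M * x 0 ^ 2 < m * rho ^ 2 ->
  sys_sol g dg r I xg yg ug vg -> sys_init xg yg ug vg (x 0) (y 0) (u 0) (v 0) ->
  (forall s, between 0 t s -> I s) ->
  xg t = x t /\ yg t = y t /\ ug t = u t /\ vg t = v t.
Proof.
  intros Hx Hy S Hg [X0 [Y0 [U0 V0]]] HI; pose proof (ext_tame _ _ _ _ _ _ _ _ X) as H.
  assert (E : forall s, between 0 t s -> xg s = x s /\ ug s = u s /\ - rho < xg s < rho).
  { intros s Hs; apply (sol2_unique _ _ _ _ _ _ _ _ X); auto.
    intros q Hq; destruct (Hg q (HI q (between_trans _ _ _ _ Hs Hq))) as [B [H1 [H2 _]]]; auto. }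
  assert (F : yg t = y t /\ vg t = v t).
  { apply (second_order_unique yg vg (fun s => - dg (xg s) * yg s)
             y v (fun s => - dG (x s) * y s) M 0); auto.
    - left; apply (tame_M_pos _ _ _ _ H).
    - intros s Hs; destruct (Hg s (HI s Hs)) as [_ [_ [_ [H3 H4]]]].
      split; [auto|split; [apply Hy|]].
      destruct (E s Hs) as [Ex [_ B]].
      destruct (ext_agree _ _ _ _ _ _ _ _ X (xg s)) as [_ <-]; [lra|]; rewrite Ex.
      replace (- dG (x s) * yg s - - dG (x s) * y s) with (- (dG (x s) * (yg s - y s))) by ring.
      rewrite Rabs_Ropp, Rabs_mult.
      apply Rmult_le_compat_r; [apply Rabs_pos | apply (tame_abs _ _ _ _ H)]. }
  destruct (E t (between_r _ _)) as [? [? _]], F; auto.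
Qed.

(** * Isochronous centers and constant half periods *)

Lemma center_isochronous g dg r G dG m M rho (X : extension g dg r G dG m M rho) :
  loc_iso_center g r -> exists T k, 0 < T /\ 0 < k <= rho /\ isochronous_below G T k.
Proof.
  intros [a [b [Hab [Ha [Hb [_ [_ [_ [T [PT Per]]]]]]]]]].
  pose proof (ext_tame _ _ _ _ _ _ _ _ X) as H; pose proof (ext_radius _ _ _ _ _ _ _ _ X) as Hr.
  pose proof (tame_pos _ _ _ _ H) as Hm; pose proof (tame_ratio _ _ _ _ H) as HM.
  (* Below [rho / 2] the ratio bound [M < 4 * m] gives [M * A ^ 2 < m * rho ^ 2], so the orbit stays
     where [g] and [G] agree. *)
  exists T, (Rmin b (rho / 2)).
  pose proof (Rmin_l b (rho / 2)); pose proof (Rmin_r b (rho / 2)).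
  split; [exact PT|split; [split; [apply Rmin_glb_lt; lra | lra]|]].
  intros A x u HA Hx X0 U0.
  assert (S : u 0 ^ 2 + M * x 0 ^ 2 < m * rho ^ 2).
  { rewrite X0, U0. assert (A ^ 2 < (rho / 2) ^ 2) by nra. nra. }
  pose proof (osc_confined _ _ _ _ H x u rho Hx ltac:(lra) S) as Cf.
  assert (Hg : sol2 g r (fun _ => True) x u).
  { intros t _; specialize (Cf t); destruct (Hx t) as [D1 D2]; split; [lra|].
    destruct (ext_agree _ _ _ _ _ _ _ _ X (x t) ltac:(lra)) as [<- _]; auto. }
  destruct (Per A) as [_ P]; [lra|lra|]. specialize (P x u Hg X0 U0).
  destruct (turn_exists _ _ _ _ H x u Hx) as [t1 [Tn _]]; [lra|exact U0|].
  pose proof (turn_min_period _ _ _ _ H x u t1 Hx ltac:(lra) U0 Tn) as P'.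
  rewrite (min_period_unique _ _ _ _ P P').
  now replace (2 * t1 / 2) with t1 by field.
Qed.

Lemma sgn_pos s : sgn s = 1 <-> 0 < s.
Proof. unfold sgn; destruct (Rlt_dec 0 s), (Rlt_dec s 0); lra. Qed.

Lemma sgn_neg s : sgn s = -1 <-> s < 0.
Proof. unfold sgn; destruct (Rlt_dec 0 s), (Rlt_dec s 0); lra. Qed.

Lemma sgn_zero s : sgn s = 0 <-> s = 0.
Proof. unfold sgn; destruct (Rlt_dec 0 s), (Rlt_dec s 0); lra. Qed.

Lemma isochronous_center g dg r G dG m M rho (X : extension g dg r G dG m M rho) T k :
  0 < T -> 0 < k <= rho -> isochronous_below G T k -> loc_iso_center g r.
Proof.
  intros PT Hk Iso.
  pose proof (ext_tame _ _ _ _ _ _ _ _ X) as H; pose proof (ext_radius _ _ _ _ _ _ _ _ X) as Hr.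
  pose proof (tame_pos _ _ _ _ H) as Hm; pose proof (tame_ratio _ _ _ _ H) as HM.
  (* With [M < 4 * m], the potential at [k / 4] is below the potential at [- (k / 2)], so its level
     is attained on the negative side as well. *)
  set (b := k / 4).
  assert (Hk2 : 0 < k ^ 2) by (apply pow_lt; lra).
  assert (Vb : 2 * V G b < m * (k / 2) ^ 2).
  { pose proof (V_bounds _ _ _ _ H b); unfold b in *; nra. }
  assert (Vb0 : 0 < V G b).
  { rewrite <- (V_0 G); apply (V_increasing _ _ _ _ H); unfold b; lra. }
  assert (CV : forall s, continuity_pt (V G) s).
  { intros s; eapply deriv_continuity, (V_deriv _ _ _ _ H). }
  (* Both ends of the interval lie on one level of the potential, so that the involution maps the
     interval to itself. *)
  destruct (ivt (V G) (- (k / 2)) 0 (V G b)) as [a [Ha Ea]]; [intros; apply CV| |].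
  { rewrite V_0; pose proof (V_bounds _ _ _ _ H (- (k / 2))).
    replace ((- (k / 2)) ^ 2) with ((k / 2) ^ 2) in * by ring. nra. }
  rewrite between_le in Ha by lra.
  assert (Na : a < 0).
  { destruct (Req_dec a 0) as [Z|]; [rewrite Z, V_0 in Ea; lra|lra]. }
  assert (Vab : forall s, a < s < b -> V G s < V G b).
  { intros s Hs; destruct (Rtotal_order s 0) as [L|[->|L]].
    - rewrite <- Ea; apply (V_decreasing _ _ _ _ H); lra.
    - now rewrite V_0.
    - apply (V_increasing _ _ _ _ H); lra. }
  assert (Eq : forall s, a < s < b -> V g s = V G s).
  { intros s Hs; apply (V_agree _ _ _ _ _ _ _ _ X); unfold b in *; lra. }
  exists a, b; split; [unfold b; lra|split; [lra|split; [unfold b; lra|]]].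
  split; [|split; [|split]].
  - intros s1 s2 H1 H2 H3; rewrite !Eq by lra; apply (V_increasing _ _ _ _ H); lra.
  - intros s1 s2 H1 H2 H3; rewrite !Eq by (unfold b; lra); apply (V_decreasing _ _ _ _ H); lra.
  - intros s Hs; pose proof (Vab s Hs) as Vs; rewrite (Eq s Hs).
    destruct (Rtotal_order s 0) as [L|[->|L]].
    + assert (Ps : 0 < V G s).
      { rewrite <- (V_0 G); apply (V_decreasing _ _ _ _ H); lra. }
      rewrite (proj2 (sgn_neg s) L).
      destruct (ivt (V G) 0 b (V G s)) as [z [Hz Ez]]; [intros; apply CV|rewrite V_0; nra|].
      rewrite between_le in Hz by (unfold b; lra).
      assert (Hz' : 0 < z < b).
      { destruct (Req_dec z 0) as [Z|]; [rewrite Z, V_0 in Ez; lra|].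
        destruct (Req_dec z b) as [Z|]; [rewrite Z in Ez; lra|lra]. }
      exists z; split.
      * split; [lra|split; [rewrite Eq by lra; exact Ez|]].
        rewrite (proj2 (sgn_pos z)); lra.
      * intros z' [B [E S]]; rewrite Eq in E by lra.
        assert (0 < z') by (apply sgn_pos; lra).
        destruct (Rtotal_order z z') as [Q|[Q|Q]]; [|exact Q|].
        -- pose proof (V_increasing _ _ _ _ H z z'); lra.
        -- pose proof (V_increasing _ _ _ _ H z' z); lra.
    + rewrite (proj2 (sgn_zero 0) eq_refl).
      exists 0; split.
      * split; [lra|split; [now rewrite Eq|]]. rewrite (proj2 (sgn_zero 0) eq_refl); ring.
      * intros z' [B [E S]]; symmetry; apply sgn_zero; lra.
    + assert (Ps : 0 < V G s).
      { rewrite <- (V_0 G); apply (V_increasing _ _ _ _ H); lra. }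
      rewrite (proj2 (sgn_pos s) L).
      destruct (ivt (V G) a 0 (V G s)) as [z [Hz Ez]]; [intros; apply CV|rewrite V_0, Ea; nra|].
      rewrite between_le in Hz by lra.
      assert (Hz' : a < z < 0).
      { destruct (Req_dec z 0) as [Z|]; [rewrite Z, V_0 in Ez; lra|].
        destruct (Req_dec z a) as [Z|]; [rewrite Z in Ez; lra|lra]. }
      exists z; split.
      * split; [lra|split; [rewrite Eq by lra; exact Ez|]].
        rewrite (proj2 (sgn_neg z)); lra.
      * intros z' [B [E S]]; rewrite Eq in E by lra.
        assert (z' < 0) by (apply sgn_neg; lra).
        destruct (Rtotal_order z z') as [Q|[Q|Q]]; [|exact Q|].
        -- pose proof (V_decreasing _ _ _ _ H z z'); lra.
        -- pose proof (V_decreasing _ _ _ _ H z' z); lra.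
  - exists T; split; [exact PT|]; intros s Hs Zs.
    assert (S : 0 ^ 2 + M * s ^ 2 < m * k ^ 2).
    { pose proof (Vab s Hs); pose proof (V_bounds _ _ _ _ H s); pose proof (pow2_ge_0 s); nra. }
    assert (S' : 0 ^ 2 + M * s ^ 2 < m * rho ^ 2).
    { assert (k ^ 2 <= rho ^ 2) by (apply pow_incr; lra). nra. }
    destruct (osc_exists _ _ _ _ H s 0) as [x [u [Hx [X0 U0]]]].
    assert (Sk : u 0 ^ 2 + M * x 0 ^ 2 < m * k ^ 2) by now rewrite X0, U0.
    assert (Sr : u 0 ^ 2 + M * x 0 ^ 2 < m * rho ^ 2) by now rewrite X0, U0.
    split.
    + exists x, u; split; [|auto].
      intros t _; destruct (Hx t) as [H1 H2].
      pose proof (osc_confined _ _ _ _ H x u k Hx ltac:(lra) Sk t).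
      destruct (ext_agree _ _ _ _ _ _ _ _ X (x t) ltac:(lra)) as [<- _]; split; [lra|auto].
    + intros xg ug Hg Xg Ug.
      assert (P : min_period2 x u T).
      { apply (isochronous_min_period _ _ _ _ H T k); auto; lra. }
      assert (E : forall t, xg t = x t /\ ug t = u t).
      { intros t; destruct (sol2_unique _ _ _ _ _ _ _ _ X x u xg ug t) as [E1 [E2 _]]; auto; try lra.
        intros q _; now apply Hg. }
      destruct P as [P1 [P2 P3]]; split; [exact P1|split].
      * intros t; destruct (E t) as [-> ->], (E (t + T)) as [-> ->]; apply P2.
      * intros q Hq; destruct (E q) as [-> ->], (E 0) as [-> ->]; now apply P3.
Qed.

(** * Periodicity and stability in the isochronous case *)

Lemma small_data m M k : 0 < m -> 0 < M -> 0 < k ->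
  exists d, 0 < d /\ forall x0 u0, x0 ^ 2 + u0 ^ 2 < d ^ 2 -> u0 ^ 2 + M * x0 ^ 2 < m * k ^ 2.
Proof.
  intros Hm HM Hk.
  assert (P : 0 < m * k ^ 2 / (1 + M)).
  { apply Rdiv_lt_0_compat; [apply Rmult_lt_0_compat; [lra|now apply pow_lt]|lra]. }
  exists (sqrt (m * k ^ 2 / (1 + M))); split; [now apply sqrt_lt_R0|].
  intros x0 u0 L; rewrite pow2_sqrt in L by lra.
  apply Rlt_div_r in L; [|lra].
  pose proof (pow2_ge_0 x0); pose proof (pow2_ge_0 u0); nra.
Qed.

Lemma norm4_sqr a b c d : norm4 a b c d ^ 2 = a ^ 2 + b ^ 2 + c ^ 2 + d ^ 2.
Proof.
  unfold norm4; apply pow2_sqrt.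
  pose proof (pow2_ge_0 a); pose proof (pow2_ge_0 b); pose proof (pow2_ge_0 c);
    pose proof (pow2_ge_0 d); lra.
Qed.

Lemma norm4_lt a b c d e :
  0 < e -> norm4 a b c d < e <-> a ^ 2 + b ^ 2 + c ^ 2 + d ^ 2 < e ^ 2.
Proof.
  intros He; rewrite <- norm4_sqr.
  assert (0 <= norm4 a b c d) by apply sqrt_pos. split; intros; nra.
Qed.

Lemma isochronous_all_periodic g dg r G dG m M rho (X : extension g dg r G dG m M rho) T k :
  0 < T -> 0 < k <= rho -> isochronous_below G T k -> all_periodic_same_period g dg r.
Proof.
  intros PT Hk Iso.
  pose proof (ext_tame _ _ _ _ _ _ _ _ X) as H.
  pose proof (tame_pos _ _ _ _ H) as Hm; pose proof (tame_M_pos _ _ _ _ H) as HM.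
  exists T; split; [exact PT|].
  destruct (small_data m M k Hm HM ltac:(lra)) as [d [Hd Sm]].
  exists d; split; [exact Hd|]; intros x0 y0 u0 v0 L.
  assert (S : u0 ^ 2 + M * x0 ^ 2 < m * k ^ 2).
  { apply Sm. pose proof (pow2_ge_0 x0); pose proof (pow2_ge_0 u0).
    rewrite <- (pow2_sqrt (x0 ^ 2 + u0 ^ 2)) by lra.
    pose proof (sqrt_pos (x0 ^ 2 + u0 ^ 2)); nra. }
  assert (S' : u0 ^ 2 + M * x0 ^ 2 < m * rho ^ 2).
  { assert (k ^ 2 <= rho ^ 2) by (apply pow_incr; lra). nra. }
  destruct (sys_exists _ _ _ _ _ _ _ _ X x0 y0 u0 v0 S')
    as [x [y [u [v [Hx [Hy [[X0 [Y0 [U0 V0]]] Hs]]]]]]].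
  split; [exists x, y, u, v; split; [apply Hs|now repeat split]|].
  subst x0 y0 u0 v0; intros xg yg ug vg Hg Ig.
  assert (E : forall t, xg t = x t /\ yg t = y t /\ ug t = u t /\ vg t = v t).
  { intros t; apply (sys_unique _ _ _ _ _ _ _ _ X x y u v xg yg ug vg (fun _ => True)); auto. }
  split.
  - intros t; destruct (E t) as [-> [-> [-> ->]]], (E (t + T)) as [-> [-> [-> ->]]].
    destruct (isochronous_periodic _ _ _ _ H T k x u Iso ltac:(lra) Hx S t).
    destruct (isochronous_lin_periodic _ _ _ _ H T k x u y v Iso ltac:(lra) PT Hx S Hy t).
    auto.
  - intros N s Hs2; destruct (E s) as [-> [-> [-> ->]]]; intros [Ex [Ey [Eu Ev]]].
    (* A moving planar part already has minimal period [T]. With the planar part at rest, [y] is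
       harmonic, and the frequency identity gives minimality. *)
    destruct (classic (x 0 = 0 /\ u 0 = 0)) as [[Z1 Z2]|N'].
    + pose proof (isochronous_frequency _ _ _ _ H T k Iso ltac:(lra) PT) as Fr.
      pose proof (tame_bounds _ _ _ _ H 0) as B.
      assert (Hy' : lin (fun _ => sqrt (dG 0) ^ 2) y v).
      { intros t; rewrite pow2_sqrt by lra.
        destruct (osc_unique _ _ _ _ H x u _ _ 0 Hx (osc_zero _ _ _ _ H) Z1 Z2 t) as [Et _].
        replace (dG 0) with (dG (x t)) by now rewrite Et. apply Hy. }
      apply (lin_const_no_return (sqrt (dG 0)) y v T s); auto; [apply sqrt_lt_R0; lra|tauto].
    + destruct (isochronous_min_period _ _ _ _ H T k x u Iso ltac:(lra) Hx N' S) as [_ [_ P3]].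
      now apply (P3 s).
Qed.

Lemma isochronous_stable g dg r G dG m M rho (X : extension g dg r G dG m M rho) T k :
  0 < T -> 0 < k <= rho -> isochronous_below G T k -> lyap_stable g dg r.
Proof.
  intros PT Hk Iso eps Heps.
  pose proof (ext_tame _ _ _ _ _ _ _ _ X) as H.
  pose proof (tame_pos _ _ _ _ H) as Hm; pose proof (tame_M_pos _ _ _ _ H) as HM.
  destruct (small_data m M k Hm HM ltac:(lra)) as [d [Hd Sm]].
  set (E := exp ((2 + M) * T)).
  assert (HE : 1 <= E).
  { unfold E; rewrite <- exp_0; apply exp_monotone, Rmult_le_pos; lra. }
  (* Within one period the squared norm grows at most by [E <= E ^ 2], hence the norm at most by
     [E]. *)
  exists (Rmin d (eps / E)); split.
  { apply Rmin_glb_lt; [exact Hd | apply Rdiv_lt_0_compat; lra]. }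
  intros x0 y0 u0 v0 L.
  assert (L1 : norm4 x0 y0 u0 v0 < d) by (eapply Rlt_le_trans; [exact L | apply Rmin_l]).
  assert (L2 : norm4 x0 y0 u0 v0 < eps / E) by (eapply Rlt_le_trans; [exact L | apply Rmin_r]).
  apply norm4_lt in L1; [|exact Hd].
  assert (S : u0 ^ 2 + M * x0 ^ 2 < m * k ^ 2).
  { apply Sm; pose proof (pow2_ge_0 y0); pose proof (pow2_ge_0 v0); lra. }
  assert (S' : u0 ^ 2 + M * x0 ^ 2 < m * rho ^ 2).
  { assert (k ^ 2 <= rho ^ 2) by (apply pow_incr; lra). nra. }
  destruct (sys_exists _ _ _ _ _ _ _ _ X x0 y0 u0 v0 S')
    as [x [y [u [v [Hx [Hy [[X0 [Y0 [U0 V0]]] Hs]]]]]]].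
  split.
  { exists (-1); split; [lra|]. exists x, y, u, v; split; [apply Hs|now repeat split]. }
  subst x0 y0 u0 v0; intros a b xg yg ug vg Hab Hg Ig t Ht.
  destruct (sys_unique _ _ _ _ _ _ _ _ X x y u v xg yg ug vg (fun t => a < t < b) t)
    as [-> [-> [-> ->]]]; auto.
  { intros s Hs2; rewrite between_le in Hs2 by lra; lra. }
  (* Induction on the number of periods; after the first one, periodicity moves the time back by
     [T]. *)
  assert (B : forall n t, 0 <= t <= INR n * T -> norm4 (x t) (y t) (u t) (v t) < eps).
  { clear t Ht; induction n as [|n IH]; intros t Ht.
    - simpl in Ht; replace t with 0 by lra.
      eapply Rlt_le_trans; [exact L2|]. apply Rle_div_l; [lra|]. nra.
    - destruct (Rle_dec t T) as [Q|Q].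
      + apply norm4_lt; [exact Heps|].
        pose proof (osc_close _ _ _ _ H x u _ _ 0 t Hx (osc_zero _ _ _ _ H)) as B1.
        pose proof (second_order_bound y v (fun s => - dG (x s) * y s) M 0 0 t ltac:(lra)) as B2.
        cbv beta in B1, B2; rewrite !Rminus_0_r in B1; rewrite Rminus_0_r in B2; rewrite (Rabs_right t) in B1, B2 by lra.
        assert (B3 : exp ((2 + M) * t) <= E).
        { apply exp_monotone, Rmult_le_compat_l; lra. }
        assert (B4 : y t ^ 2 + v t ^ 2 <= (y 0 ^ 2 + v 0 ^ 2) * exp ((2 + M) * t)).
        { eapply Rle_trans; [apply B2|right; ring].
          intros s _; destruct (Hy s) as [H1 H2]; split; [exact H1|split; [exact H2|]].
          rewrite Rabs_mult, Rabs_Ropp, Rplus_0_r.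
          apply Rmult_le_compat_r; [apply Rabs_pos | apply (tame_abs _ _ _ _ H)]. }
        apply Rlt_div_r in L2; [|lra].
        set (N0 := norm4 (x 0) (y 0) (u 0) (v 0)) in *.
        assert (PN : 0 <= N0) by apply sqrt_pos.
        assert (EN : N0 ^ 2 = x 0 ^ 2 + y 0 ^ 2 + u 0 ^ 2 + v 0 ^ 2) by apply norm4_sqr.
        apply Rle_lt_trans with (N0 ^ 2 * E).
        * apply Rle_trans with (N0 ^ 2 * exp ((2 + M) * t)); [rewrite EN; lra|].
          apply Rmult_le_compat_l; [apply pow2_ge_0 | exact B3].
        * assert (PE : 0 <= N0 * E) by (apply Rmult_le_pos; lra).
          apply Rle_lt_trans with ((N0 * E) ^ 2); [|nra].
          rewrite Rpow_mult_distr; apply Rmult_le_compat_l; [apply pow2_ge_0|nra].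
      + rewrite S_INR in Ht.
        destruct (isochronous_periodic _ _ _ _ H T k x u Iso ltac:(lra) Hx S (t - T)) as [E1 E2].
        destruct (isochronous_lin_periodic _ _ _ _ H T k x u y v Iso ltac:(lra) PT Hx S Hy (t - T))
          as [E3 E4].
        replace (t - T + T) with t in * by ring.
        rewrite E1, E2, E3, E4; apply IH; lra. }
  destruct (INR_unbounded (t / T)) as [n Hn].
  apply (B n); apply Rlt_div_l in Hn; lra.
Qed.

(** * Unbounded solutions and instability *)

Lemma not_isochronous_unbounded g dg r G dG m M rho (X : extension g dg r G dG m M rho) :
  ~ loc_iso_center g r -> unbounded_near_origin g dg r.
Proof.
  intros NC.
  pose proof (ext_tame _ _ _ _ _ _ _ _ X) as H; pose proof (ext_radius _ _ _ _ _ _ _ _ X) as Hr.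
  pose proof (tame_pos _ _ _ _ H) as Hm; pose proof (tame_ratio _ _ _ _ H) as HM.
  assert (Seq : forall n : nat, exists A, 0 < A < / (INR n + 1) /\
     (exists a, a < 0 /\ exists x y u v,
          sys_sol g dg r (fun t => a < t) x y u v /\ sys_init x y u v A A 0 0) /\
     (forall a x y u v, a < 0 -> sys_sol g dg r (fun t => a < t) x y u v ->
          sys_init x y u v A A 0 0 ->
          ~ (exists M, forall t, 0 <= t -> norm4 (x t) (y t) (u t) (v t) <= M))).
  { intros n.
    assert (Pn : 0 < / (INR n + 1)) by (apply Rinv_0_lt_compat; pose proof (pos_INR n); lra).
    set (k := Rmin (rho / 2) (/ (INR n + 1))).
    assert (Hk : 0 < k) by (apply Rmin_glb_lt; lra).
    assert (Hk1 : k <= rho / 2) by apply Rmin_l.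
    assert (Hk2 : k <= / (INR n + 1)) by apply Rmin_r.
    (* If no amplitude below [k] gave an unbounded solution, every variational solution below [k]
       would be at rest at the turning time, and the origin would be a center. *)
    clearbody k; apply NNPP; intros NS; apply NC.
    destruct (rest_at_turn_isochronous _ _ _ _ H k Hk) as [T [PT Iso]];
      [|apply (isochronous_center _ _ _ _ _ _ _ _ X T k); auto; lra].
    intros x u y v t1 Hx X0 U0 Tn Hy Y0 V0; apply NNPP; intros Nv; apply NS.
    pose proof (variational_unbounded _ _ _ _ H x u y v t1 Hx (proj1 X0) U0 Tn Hy Y0 V0 Nv) as Ub.
    set (A := x 0) in *.
    assert (S : u 0 ^ 2 + M * x 0 ^ 2 < m * rho ^ 2).
    { fold A; rewrite U0; assert (A ^ 2 < (rho / 2) ^ 2) by nra. nra. }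
    (* The multiple [A * y], written as a combination with zero second weight. Using the amplitude
       as scale makes the initial data [(A, A, 0, 0)] small with [A], and unboundedness survives
       scaling. *)
    pose proof (lin_comb _ _ _ _ _ A 0 Hy Hy) as Hy'.
    pose proof (osc_sys_sol _ _ _ _ _ _ _ _ X x _ u _ Hx Hy' S) as Sol.
    assert (Y0' : A * y 0 + 0 * y 0 = A) by (rewrite Y0; ring).
    assert (V0' : A * v 0 + 0 * v 0 = 0) by (rewrite V0; ring).
    exists A; split; [lra|split].
    - exists (-1); split; [lra|]; do 4 eexists; split; [apply Sol|now repeat split].
    - intros a xg yg ug vg Ha Hg Ig [K B].
      destruct (Ub (K / A)) as [t [Ht L]].
      destruct (sys_unique _ _ _ _ _ _ _ _ X x _ u _ xg yg ug vg (fun t => a < t) t Hx Hy' S Hg)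
        as [_ [_ [_ Ev]]].
      { now rewrite Y0', V0', U0. }
      { intros s Hs; rewrite between_le in Hs by lra; lra. }
      specialize (B t Ht); apply Rlt_div_l in L; [|lra].
      assert (L' : Rabs (vg t) <= K).
      { eapply Rle_trans; [|exact B].
        apply pow2_le_abs; [apply sqrt_pos|rewrite norm4_sqr].
        pose proof (pow2_ge_0 (xg t)); pose proof (pow2_ge_0 (yg t)); pose proof (pow2_ge_0 (ug t)); lra. }
      rewrite Ev, Rmult_0_l, Rplus_0_r, Rabs_mult, (Rabs_right A) in L' by lra; lra. }
  apply choice in Seq as [A HA].
  exists A, A, (fun _ => 0), (fun _ => 0); split; [|intros n; apply HA].
  assert (Up : is_lim_seq (fun n => 2 * / (INR n + 1)) 0).
  { assert (L1 : is_lim_seq (fun n => INR n + 1) p_infty).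
    { apply (is_lim_seq_ext (fun n => INR (S n))); [intros; apply S_INR|].
      apply (is_lim_seq_incr_1 INR p_infty), is_lim_seq_INR. }
    assert (L2 : is_lim_seq (fun n => / (INR n + 1)) 0).
    { apply (is_lim_seq_inv _ p_infty) in L1; [exact L1|discriminate]. }
    replace (Finite 0) with (Rbar_mult 2 0) by (simpl; f_equal; ring).
    now apply (is_lim_seq_scal_l _ 2 0). }
  apply (is_lim_seq_le_le (fun _ => 0) _ (fun n => 2 * / (INR n + 1)) 0);
    [|apply is_lim_seq_const|exact Up].
  intros n; split; [apply sqrt_pos|]. destruct (HA n) as [B _].
  left; apply norm4_lt; [lra|]. nra.
Qed.

Lemma unbounded_unstable g dg r : unbounded_near_origin g dg r -> ~ lyap_stable g dg r.
Proof.
  intros [X [Y [U [W [L Ub]]]]] St.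
  destruct (St 1 Rlt_0_1) as [d [Hd B]].
  apply is_lim_seq_spec in L; destruct (L (mkposreal d Hd)) as [n Hn].
  specialize (Hn n (le_n n)); simpl in Hn; rewrite Rminus_0_r in Hn.
  destruct (B (X n) (Y n) (U n) (W n)) as [_ B'].
  { eapply Rle_lt_trans; [apply Rle_abs | exact Hn]. }
  destruct (Ub n) as [[a [Ha [x [y [u [v [Hs Hi]]]]]]] Nb].
  (* Stability is applied on a bounded interval, so each time [t] uses the restriction of the
     solution to [(a, t + 1)]. *)
  apply (Nb a x y u v Ha Hs Hi); exists 1; intros t Ht; left.
  apply (B' a (t + 1) x y u v); auto; [lra| |lra].
  intros s Hs2; apply Hs; lra.
Qed.

(** * Absence of asymptotic motions *)

Lemma zero_of_small a : (forall e, 0 < e -> a <= e) -> 0 <= a -> a = 0.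
Proof.
  intros B P; destruct (Req_dec a 0) as [E|E]; [exact E|]. specialize (B (a / 2)); lra.
Qed.

(** Two stages: the planar energy, arbitrarily small in the past, forces [x] and [u] to vanish; on
    that plane the [y] equation is harmonic and has a positive definite energy of its own. *)
Lemma tame_no_asymptotic g dg r G dG m M rho (X : extension g dg r G dG m M rho) :
  no_asymptotic_motions g dg r.
Proof.
  intros T x y u v Hs L.
  pose proof (ext_tame _ _ _ _ _ _ _ _ X) as H; pose proof (ext_radius _ _ _ _ _ _ _ _ X) as Hr.
  pose proof (tame_pos _ _ _ _ H) as Hm; pose proof (tame_ratio _ _ _ _ H) as HM.
  assert (Past : forall e t, 0 < e -> exists t0, t0 < t /\
     x t0 ^ 2 + y t0 ^ 2 + u t0 ^ 2 + v t0 ^ 2 < e).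
  { intros e t He; apply is_lim_spec in L.
    destruct (L (mkposreal _ (sqrt_lt_R0 e He))) as [t1 Ht1]; simpl in Ht1.
    pose proof (Rmin_l t t1); pose proof (Rmin_r t t1).
    exists (Rmin t t1 - 1); split; [lra|].
    specialize (Ht1 (Rmin t t1 - 1) ltac:(lra)); rewrite Rminus_0_r in Ht1.
    rewrite <- (pow2_sqrt e) by lra.
    apply norm4_lt; [now apply sqrt_lt_R0|]. eapply Rle_lt_trans; [apply Rle_abs | exact Ht1]. }
  assert (XU : forall t, t < T -> x t = 0 /\ u t = 0).
  { intros t Ht.
    assert (Z : u t ^ 2 + m * x t ^ 2 = 0).
    { pose proof (pow2_ge_0 (u t)); pose proof (pow2_ge_0 (x t)).
      apply zero_of_small; [|nra]; intros e He.
      assert (PR : 0 < m * rho ^ 2) by (apply Rmult_lt_0_compat; [lra | apply pow_lt; lra]).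
      (* The bound [m * rho ^ 2] provides trapping and [e] the smallness; dividing by [1 + M] pays
         for the weight in [u ^ 2 + M * x ^ 2]. *)
      destruct (Past (Rmin e (m * rho ^ 2) / (1 + M)) t) as [t0 [L0 S]].
      { apply Rdiv_lt_0_compat; [now apply Rmin_glb_lt|lra]. }
      apply Rlt_div_r in S; [|lra].
      pose proof (Rmin_l e (m * rho ^ 2)); pose proof (Rmin_r e (m * rho ^ 2)).
      pose proof (pow2_ge_0 (u t0)); pose proof (pow2_ge_0 (x t0));
        pose proof (pow2_ge_0 (y t0)); pose proof (pow2_ge_0 (v t0)).
      assert (u t0 ^ 2 + M * x t0 ^ 2 < Rmin e (m * rho ^ 2)) by nra.
      destruct (trapped _ _ _ _ _ _ _ _ X x u t0 t) as [_ B]; [|lra|lra].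
      intros s Hs2; rewrite between_le in Hs2 by lra.
      destruct (Hs s ltac:(lra)) as [? [? [? _]]]; auto. }
    pose proof (pow2_ge_0 (u t)); pose proof (pow2_ge_0 (x t)).
    split; apply Rsqr_0_uniq; unfold Rsqr; nra. }
  destruct (ext_force _ _ _ _ _ _ _ _ X) as [_ [_ [_ [_ Pw]]]].
  intros t Ht; destruct (XU t Ht) as [-> ->].
  assert (Z : v t ^ 2 + dg 0 * y t ^ 2 = 0).
  { pose proof (pow2_ge_0 (v t)); pose proof (pow2_ge_0 (y t)).
    apply zero_of_small; [|nra]; intros e He.
    destruct (Past (e / (1 + dg 0)) t) as [t0 [L0 S]].
    { apply Rdiv_lt_0_compat; lra. }
    apply Rlt_div_r in S; [|lra].
    assert (E : v t ^ 2 + dg 0 * y t ^ 2 = v t0 ^ 2 + dg 0 * y t0 ^ 2).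
    { apply (constant_between (fun s => v s ^ 2 + dg 0 * y s ^ 2) (fun _ => 0)).
      intros s Hs2; rewrite between_le in Hs2 by lra; split; [|reflexivity].
      destruct (Hs s ltac:(lra)) as [_ [_ [_ [H3 H4]]]].
      rewrite (proj1 (XU s ltac:(lra))) in H4; deriv; ring. }
    pose proof (pow2_ge_0 (u t0)); pose proof (pow2_ge_0 (x t0));
      pose proof (pow2_ge_0 (y t0)); pose proof (pow2_ge_0 (v t0)); nra. }
  pose proof (pow2_ge_0 (v t)); pose proof (pow2_ge_0 (y t)).
  split; [reflexivity|split; [|split; [reflexivity|]]]; apply Rsqr_0_uniq; unfold Rsqr; nra.
Qed.

Theorem theorem3p3 (g dg : R -> R) (r : R) :
  0 < r ->
  (forall s, -r < s < r -> is_derive g s (dg s)) ->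
  (forall s, -r < s < r -> continuous dg s) ->
  g 0 = 0 -> 0 < dg 0 ->
  (lyap_stable g dg r <-> loc_iso_center g r) /\
  (loc_iso_center g r -> all_periodic_same_period g dg r) /\
  (~ lyap_stable g dg r ->
     unbounded_near_origin g dg r /\ no_asymptotic_motions g dg r).
Proof.
  intros Hr Dg Cg g0 P0.
  destruct (extension_exists g dg r) as [G [dG [m [M [rho X]]]]].
  { unfold smooth_force; auto. }
  assert (Stable : loc_iso_center g r -> lyap_stable g dg r).
  { intros C; destruct (center_isochronous _ _ _ _ _ _ _ _ X C) as [T [k [PT [Hk Iso]]]].
    exact (isochronous_stable _ _ _ _ _ _ _ _ X T k PT Hk Iso). }
  split; [split|split].
  - intros St; apply NNPP; intros NC.
    exact (unbounded_unstable g dg r (not_isochronous_unbounded _ _ _ _ _ _ _ _ X NC) St).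
  - exact Stable.
  - intros C; destruct (center_isochronous _ _ _ _ _ _ _ _ X C) as [T [k [PT [Hk Iso]]]].
    exact (isochronous_all_periodic _ _ _ _ _ _ _ _ X T k PT Hk Iso).
  - intros NS; split.
    + apply (not_isochronous_unbounded _ _ _ _ _ _ _ _ X); auto.
    + exact (tame_no_asymptotic _ _ _ _ _ _ _ _ X).
Qed.
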